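(* Let $\lambda,\zeta\le 0$ and $\mu\in\mathbb{R}$. If the stochastic multirate test equation $$dX(t)=(\lambda+\zeta)X(t)\,dt+\mu X(t)\,dW(t),\qquad X(0)=X_0,$$ is mean-square stable, then for every $\eta\ge 0$ the modified equation $$dX_\eta(t)=\varphi(\eta\lambda)(\lambda+\zeta)X_\eta(t)\,dt+\varphi\!\left(\tfrac{\eta}{2}\lambda\right)\mu X_\eta(t)\,dW(t),\qquad X_\eta(0)=X_0,$$ is mean-square stable.
   Context: $W$ is a one-dimensional Wiener process, the equations are Itô SDEs with scalar real solutions, and $X_0$ is a square-integrable initial value independent of $W$. The function $\varphi$ is $\varphi(z)=\frac{e^z-1}{z}$ for $z\ne 0$ and $\varphi(0)=1$. An equation with solution $Y(t)$ is called mean-square stable if $\lim_{t\to\infty}\mathbb{E}(|Y(t)|^2)=0$. For a linear scalar equation $dY=aY\,dt+bY\,dW$ (with nonzero initial value) this is the condition $a+\frac12|b|^2<0$; in particular for the stochastic multirate test equation it is $\lambda+\zeta+\frac12|\mu|^2<0$. *)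

(* Defs.v *)
From HB Require Import structures.
From mathcomp Require Import all_boot all_order all_algebra.
From mathcomp Require Import all_classical all_reals all_analysis.
Set Implicit Arguments.
Unset Strict Implicit.
Unset Printing Implicit Defensive.
Import Order.TTheory GRing.Theory Num.Theory.
Import numFieldNormedType.Exports.
Local Open Scope classical_set_scope.
Local Open Scope ring_scope.

(* Time is the half-line [0, +oo) inside R: processes are total functions of
   type R -> T -> R and nothing is ever required of them at negative times. *)
Section StochasticCalculus.
Context {d : measure_display} {T : measurableType d} {R : realType}.
Variable P : probability T R.

Definition independent_systems (G H : set (set T)) : Prop :=
  forall A B, G A -> H B -> P (A `&` B) = (P A * P B)%E.

Definition measurable_wrt (G : set (set T)) (X : T -> R) : Prop :=
  preimage_set_system setT X measurable `<=` G.

Definition sigma_past (W : R -> T -> R) (t : R) : set (set T) :=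
  <<s \bigcup_(u in `[0, t]) preimage_set_system setT (W u) measurable >>.

Definition sigma_all (W : R -> T -> R) : set (set T) :=
  <<s \bigcup_(u in `[0, +oo[) preimage_set_system setT (W u) measurable >>.

(* [normal_prob m s] takes the standard deviation [s], and is not a point mass
   when [s = 0], hence the strict inequality between the two times. *)
Definition wiener_process (W : R -> T -> R) : Prop :=
  [/\ forall t : R, 0 <= t -> measurable_fun setT (W t),
      {ae P, forall w, W 0 w = 0},
      (forall s t : R, 0 <= s -> s < t ->
        forall B : set R, measurable B ->
          P ((W t \- W s) @^-1` B) = normal_prob 0 (Num.sqrt (t - s)) B),
      (forall s t : R, 0 <= s -> s < t ->
        independent_systems
          (preimage_set_system setT (W t \- W s) measurable)
          (sigma_past W s)) &
      {ae P, forall w, {within `[0, +oo[, continuous (fun t => W t w)}}].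

Definition independent_of_process (X0 : T -> R) (W : R -> T -> R) : Prop :=
  independent_systems (preimage_set_system setT X0 measurable) (sigma_all W).

Definition second_moment (X : T -> R) : \bar R :=
  'E_P[fun w : T => `|X w| ^+ 2].

Definition square_integrable (X : T -> R) : Prop :=
  measurable_fun setT X /\ (second_moment X < +oo)%E.

(* The filtration generated by the initial value and the Wiener process,
   augmented by the (measurable) null sets. *)
Definition augmented_filtration (X0 : T -> R) (W : R -> T -> R) (t : R) :
    set (set T) :=
  <<s preimage_set_system setT X0 measurable
      `|` (\bigcup_(u in `[0, t]) preimage_set_system setT (W u) measurable)
      `|` [set N | measurable N /\ P N = 0%E] >>.

Definition energy (H : R -> T -> R) (t : R) : \bar R :=
  (\int[P]_w
     \int[lebesgue_measure]_(s in `[0%R, t]) ((`|H s w| ^+ 2)%R)%:E)%E.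

(* The class of Ito integrands on [0, t]: jointly measurable, adapted, and
   square-integrable with respect to ds x P. *)
Definition ito_integrand (F : R -> set (set T)) (H : R -> T -> R) (t : R) :
    Prop :=
  [/\ measurable_fun (`[0, t] `*` setT) (fun p : R * T => H p.1 p.2),
      (forall s : R, 0 <= s <= t -> measurable_wrt (F s) (H s)) &
      (energy H t < +oo)%E].

(* sum_(i < n) e_i 1_[t_i, t_(i+1)[ with e_i known at time t_i. *)
Record simple_process (F : R -> set (set T)) (t : R) := SimpleProcess {
  sp_size : nat ;
  sp_time : nat -> R ;
  sp_value : nat -> T -> R ;
  sp_time0 : sp_time 0%N = 0 ;
  sp_time_end : sp_time sp_size = t ;
  sp_time_le : forall i, (i < sp_size)%N -> sp_time i <= sp_time i.+1 ;
  sp_value_adapted : forall i, (i < sp_size)%N ->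
    measurable_wrt (F (sp_time i)) (sp_value i) ;
  sp_value_sqint : forall i, (i < sp_size)%N -> square_integrable (sp_value i)
}.

Definition simple_fun (F : R -> set (set T)) (t : R) (h : simple_process F t)
    (s : R) (w : T) : R :=
  \sum_(i < sp_size h)
     sp_value h i w * \1_(`[sp_time h i, sp_time h i.+1[%classic) s.

Definition simple_ito (F : R -> set (set T)) (t : R) (h : simple_process F t)
    (W : R -> T -> R) (w : T) : R :=
  \sum_(i < sp_size h)
     sp_value h i w * (W (sp_time h i.+1) w - W (sp_time h i) w).

(* [I] is (a version of) the Ito integral of [H] against [W] over [0, t]: the
   L^2(P)-limit of the integrals of simple processes converging to [H] in
   L^2(ds x P). *)
Definition is_ito_integral (F : R -> set (set T)) (W : R -> T -> R)
    (H : R -> T -> R) (t : R) (I : T -> R) : Prop :=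
  [/\ ito_integrand F H t,
      measurable_fun setT I &
      exists h : nat -> simple_process F t,
        energy (fun s w => H s w - simple_fun (h n) s w) t @[n --> \oo]
          --> 0%E /\
        second_moment (I \- simple_ito (h n) W) @[n --> \oo]
          --> 0%E].

(* [Y] is a (strong) solution of the Ito equation
   dY = a Y dt + b Y dW, Y(0) = X0.  The energy bound makes
   s |-> Y s w integrable on [0, t] for almost every w, so the [Rintegral]
   below is a genuine Lebesgue integral almost surely. *)
Definition linear_sde_solution (W : R -> T -> R) (a b : R) (X0 : T -> R)
    (Y : R -> T -> R) : Prop :=
  let F := augmented_filtration X0 W in
  {ae P, forall w, Y 0 w = X0 w} /\
  forall t : R, 0 <= t ->
    ito_integrand F Y t /\
    exists2 I : T -> R,
      is_ito_integral F W (fun s w => b * Y s w) t I &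
      {ae P, forall w,
        Y t w = X0 w + \int[lebesgue_measure]_(s in `[0, t]) (a * Y s w)
                + I w}.

Definition mean_square_stable (Y : R -> T -> R) : Prop :=
  second_moment (Y t) @[t --> +oo%R] --> 0%E.

End StochasticCalculus.

Definition phi {R : realType} (z : R) : R :=
  if z == 0 then 1 else (expR z - 1) / z.

(* Main.v *)
Require Import Defs.
From HB Require Import structures.
From mathcomp Require Import all_boot all_order all_algebra.
From mathcomp Require Import all_classical all_reals all_analysis.
From mathcomp Require Import measurable_realfun.
From mathcomp Require Import ring lra.
Set Implicit Arguments.
Unset Strict Implicit.
Unset Printing Implicit Defensive.
Import Order.TTheory GRing.Theory Num.Theory.
Import numFieldNormedType.Exports.
Local Open Scope classical_set_scope.
Local Open Scope ring_scope.

(** The definition of the stochastic integral shapes the argument: for each t separately, I(t) is an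
    L^2 limit along its own sequence of simple processes, so the sequences for s and for t are
    unrelated and no process t |-> I(t) is given. Hence everything is phrased through inner products
    at two fixed times, and even the martingale property passes through the isometry, which compares
    the two sequences. The isometry is therefore stated for pairs of step families with arbitrary
    partitions. Two regularity facts are extracted from the equation itself: square-integrability of
    Y(t) at every t (finite energy alone controls almost every t), and continuity of m, which allows
    the integral equation to be differentiated. In the expansion, the cross term contributes 2 a int
    m - a^2 E V^2, and its second part cancels the a^2 E V^2 of the square. The inequality for phi
    is a trapezoid bound: phi z = phi (z / 2) (e^(z/2) + 1) / 2, and phi (z / 2) is the mean of exp
    over [z/2, 0], at most the mean of its two end values by convexity. *)

(* Let Y solve dY = a Y dt + b Y dW, let m(t) be its second moment, V(t) the
   integral of Y over [0, t] and I(t) the stochastic integral, so that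
   Y(t) = X0 + a V(t) + I(t).  No Ito formula is needed to compute m: expand
   the square of X0 + a V(t) + I(t) and use
   - E I(t)^2 = b^2 int_0^t m (isometry) and E X0 I(t) = 0,
   - E Y(s) I(t) = E Y(s) I(s) for s <= t (martingale property), so that by
     Fubini the cross term E (X0 + I(t)) V(t) is the integral over [0, t] of
     E Y(s) (X0 + I(s)) = m(s) - a E Y(s) V(s),
   - E V(t)^2 = 2 int_0^t E Y(s) V(s) ds (symmetry of E Y(s) Y(r)).
   Hence m(t) = m(0) + (2 a + b^2) int_0^t m, i.e.
   m(t) = m(0) exp ((2 a + b^2) t), and a solution is mean-square stable iff
   X0 = 0 almost surely or 2 a + b^2 < 0.  For the modified equation
   2 a + b^2 is at most phi (eta lambda) times its original value, because
   0 < phi and phi (z / 2)^2 <= phi z for z <= 0. *)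

(** * Square-integrable functions *)

Section L2.
Context d (T : measurableType d) (R : realType).
Variable mu : {measure set T -> \bar R}.
Implicit Types f g h : T -> R.

Definition L1 f := mu.-integrable setT (EFin \o f).
Definition L2 f := measurable_fun setT f /\ L1 (fun x => f x ^+ 2).

Lemma L1_measurable f : L1 f -> measurable_fun setT f.
Proof. by move=> /measurable_int /measurable_EFinP. Qed.

Lemma L1_le f g : measurable_fun setT f -> (forall x, `|f x| <= g x) ->
  L1 g -> L1 f.
Proof.
move=> mf fg ig; apply: le_integrable ig => //; first exact/measurable_EFinP.
by move=> x _ /=; rewrite lee_fin (le_trans (fg x))// ler_norm.
Qed.

Lemma L1D f g : L1 f -> L1 g -> L1 (fun x => f x + g x).
Proof.
by move=> If Ig; apply: eq_integrable (integrableD measurableT If Ig).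
Qed.

Lemma L1B f g : L1 f -> L1 g -> L1 (fun x => f x - g x).
Proof.
by move=> If Ig; apply: eq_integrable (integrableB measurableT If Ig).
Qed.

Lemma L1Z k f : L1 f -> L1 (fun x => k * f x).
Proof.
by move=> If; apply: eq_integrable (integrableZl measurableT k If).
Qed.

Lemma L1_sum (I : finType) (F : I -> T -> R) : (forall i, L1 (F i)) ->
  L1 (fun x => \sum_i F i x).
Proof.
move=> IF; pose h i := EFin \o F i.
apply: (@eq_integrable _ _ _ mu _ measurableT (fun x => (\sum_i h i x)%E)).
  by move=> x _ /=; rewrite sumEFin.
by apply: integrable_sum => // i _; exact: IF.
Qed.

Lemma RintegralTD f g : L1 f -> L1 g ->
  \int[mu]_x (f x + g x) = \int[mu]_x f x + \int[mu]_x g x.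
Proof. exact: RintegralD. Qed.

Lemma RintegralTB f g : L1 f -> L1 g ->
  \int[mu]_x (f x - g x) = \int[mu]_x f x - \int[mu]_x g x.
Proof. exact: RintegralB. Qed.

Lemma RintegralTZ k f : L1 f -> \int[mu]_x (k * f x) = k * \int[mu]_x f x.
Proof. exact: RintegralZl. Qed.

Lemma RintegralT_sum (I : finType) (F : I -> T -> R) : (forall i, L1 (F i)) ->
  \int[mu]_x (\sum_i F i x) = \sum_i \int[mu]_x F i x.
Proof.
move=> IF; rewrite /Rintegral.
under eq_integral do rewrite -sumEFin.
rewrite (@integral_sum _ _ _ mu _ measurableT _ (fun i => EFin \o F i))//=.
by rewrite -sum_fine// => i _; exact: (integrable_fin_num measurableT (IF i)).
Qed.

Lemma EFin_RintegralT f : L1 f ->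
  (\int[mu]_x f x)%:E = (\int[mu]_x (f x)%:E)%E.
Proof. by move=> If; rewrite fineK// integrable_fin_num. Qed.

Lemma L1P f : measurable_fun setT f -> (\int[mu]_x `|f x|%:E < +oo)%E -> L1 f.
Proof. by move=> mf fi; apply/integrableP; split => //; exact/measurable_EFinP. Qed.

Lemma L2_mul f g : L2 f -> L2 g -> L1 (fun x => f x * g x).
Proof.
move=> [mf f2] [mg g2]; apply: (@L1_le _ (fun x => f x ^+ 2 + g x ^+ 2)).
- exact: measurable_funM.
- by move=> x; rewrite ler_norml; apply/andP; split; nra.
- exact: L1D.
Qed.

Lemma L2D f g : L2 f -> L2 g -> L2 (fun x => f x + g x).
Proof.
move=> f2 g2; have fg := L2_mul f2 g2; case: f2 => mf f2; case: g2 => mg g2.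
split; first exact: measurable_funD.
have -> : (fun x => (f x + g x) ^+ 2) =
  (fun x => f x ^+ 2 + (2 * (f x * g x) + g x ^+ 2)) by apply/funext => x; ring.
by apply/L1D => //; apply/L1D => //; apply/L1Z.
Qed.

Lemma L2Z k f : L2 f -> L2 (fun x => k * f x).
Proof.
move=> [mf f2]; split; first exact: measurable_funM.
have -> : (fun x => (k * f x) ^+ 2) = (fun x => k ^+ 2 * f x ^+ 2).
  by apply/funext => x; ring.
exact: L1Z.
Qed.

Lemma L2B f g : L2 f -> L2 g -> L2 (fun x => f x - g x).
Proof.
move=> f2 g2; have -> : (fun x => f x - g x) = (fun x => f x + -1 * g x).
  by apply/funext => x; ring.
by apply: L2D => //; exact: L2Z.
Qed.

Lemma L2_0 : L2 (fun=> 0).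
Proof.
split => //; have -> : (fun=> 0 ^+ 2 : R) = (fun _ : T => 0 : R).
  by apply/funext => x; rewrite expr0n.
exact: integrable0.
Qed.

Lemma L2_sum (I : finType) (F : I -> T -> R) : (forall i, L2 (F i)) ->
  L2 (fun x => \sum_i F i x).
Proof.
move=> IF; have -> : (fun x => \sum_i F i x) = \sum_i F i.
  by apply/funext => x; rewrite fct_sumE.
elim/big_ind : _ => //; first exact: L2_0.
by move=> f g; exact: L2D.
Qed.

(** The quadratic A + 2 B y + C y^2, the integral of (f + y g)^2, is nonnegative for every y. *)
Lemma cauchy_schwarz f g : L2 f -> L2 g ->
  (\int[mu]_x (f x * g x)) ^+ 2 <= \int[mu]_x (f x ^+ 2) * \int[mu]_x (g x ^+ 2).
Proof.
move=> f2 g2; have fg := L2_mul f2 g2.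
set A := \int[mu]_x (f x ^+ 2); set B := \int[mu]_x (f x * g x).
set C := \int[mu]_x (g x ^+ 2).
have A0 : 0 <= A by apply: Rintegral_ge0 => x _; exact: sqr_ge0.
have C0 : 0 <= C by apply: Rintegral_ge0 => x _; exact: sqr_ge0.
have H y : 0 <= A + y * (2 * B + y * C).
  have : 0 <= \int[mu]_x ((f x + y * g x) ^+ 2).
    by apply: Rintegral_ge0 => x _; exact: sqr_ge0.
  have -> : (fun x => (f x + y * g x) ^+ 2) =
     (fun x => f x ^+ 2 + y * (2 * (f x * g x) + y * g x ^+ 2)).
    by apply/funext => x; ring.
  have If := f2.2; have Ig := g2.2; have Iy := L1Z y Ig; have I2 := L1Z 2 fg.
  have Is := L1D I2 Iy; have Iys := L1Z y Is.
  by rewrite RintegralTD// RintegralTZ// RintegralTD// !RintegralTZ.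
have [C00|C1] := eqVneq C 0.
  rewrite C00 mulr0; suff -> : B = 0 by rewrite expr0n.
  apply/eqP; apply: contraT => B0.
  (* With C = 0 the quadratic is affine; this y gives it the value -1. *)
  have := H (- (A + 1) / (2 * B)); rewrite C00 mulr0 addr0.
  have -> : - (A + 1) / (2 * B) * (2 * B) = - (A + 1) by field.
  by lra.
(* The minimiser of the quadratic. *)
have := H (- B / C).
have -> : A + - B / C * (2 * B + - B / C * C) = A - B ^+ 2 / C by field.
have Cp : 0 < C by rewrite lt0r C1.
by rewrite subr_ge0 ler_pdivrMr// mulrC.
Qed.

Definition L2cvg (f_ : nat -> T -> R) f :=
  \int[mu]_x ((f_ n x - f x) ^+ 2) @[n --> \oo] --> (0:R).

Lemma L2cvg_inner (f_ : nat -> T -> R) f g : L2 g ->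
  (forall n, L2 (f_ n)) -> L2 f -> L2cvg f_ f ->
  \int[mu]_x (g x * f_ n x) @[n --> \oo] --> \int[mu]_x (g x * f x).
Proof.
move=> g2 fn2 f2 cf; apply/cvgrPdist_le => e e0.
set G := \int[mu]_x (g x ^+ 2).
have G0 : 0 <= G by apply: Rintegral_ge0 => x _; exact: sqr_ge0.
(* Cauchy-Schwarz bounds the squared error by G times the squared distance; [G + 1] instead of [G]
   keeps the quotient meaningful when g is null. *)
have e1 : 0 < e ^+ 2 / (G + 1) by rewrite divr_gt0 ?exprn_gt0//; lra.
move/cvgrPdist_le : cf => /(_ _ e1); apply: filterS => n.
rewrite distrC subr0 ger0_norm; last by apply: Rintegral_ge0 => x _; exact: sqr_ge0.
move=> H; have fn := L2B (fn2 n) f2.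
have := cauchy_schwarz g2 fn.
have -> : \int[mu]_x (g x * (f_ n x - f x)) =
  \int[mu]_x (g x * f_ n x) - \int[mu]_x (g x * f x).
  rewrite -RintegralTB; [|exact: L2_mul|exact: L2_mul].
  by apply: eq_Rintegral => x _; rewrite mulrBr.
rewrite -/G => CS.
rewrite distrC -ler_sqr ?nnegrE ?normr_ge0 ?(ltW e0)// real_normK ?num_real//.
apply: (le_trans CS); apply: (le_trans (ler_wpM2l G0 H)).
rewrite mulrA ler_pdivrMr; last by lra.
by rewrite mulrC ler_pM2l ?exprn_gt0//; lra.
Qed.

(** Writing f_n^2 = (f_n - f)^2 + 2 f f_n - f^2 reduces the convergence of norms to that of the
    inner products with the fixed function f. *)
Lemma L2cvg_norm (f_ : nat -> T -> R) f :
  (forall n, L2 (f_ n)) -> L2 f -> L2cvg f_ f ->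
  \int[mu]_x (f_ n x ^+ 2) @[n --> \oo] --> \int[mu]_x (f x ^+ 2).
Proof.
move=> fn2 f2 cf.
have -> : (fun n => \int[mu]_x (f_ n x ^+ 2)) = (fun n =>
    \int[mu]_x ((f_ n x - f x) ^+ 2) +
    (2 * \int[mu]_x (f x * f_ n x) - \int[mu]_x (f x ^+ 2))).
  apply/funext => n; rewrite -RintegralTZ; last exact: L2_mul.
  have f22 := f2.2; have ff : L1 (fun x => 2 * (f x * f_ n x)).
    by apply: L1Z; exact: L2_mul.
  rewrite -RintegralTB// -RintegralTD.
  - by apply: eq_Rintegral => x _; ring.
  - by have [] := L2B (fn2 n) f2.
  - exact: L1B.
rewrite -[X in _ --> X]add0r; apply: cvgD => //.
have ff : \int[mu]_x (f x * f x) = \int[mu]_x (f x ^+ 2).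
  by apply: eq_Rintegral => x _; rewrite expr2.
have {2}-> : \int[mu]_x (f x ^+ 2) =
   2 * \int[mu]_x (f x * f x) - \int[mu]_x (f x ^+ 2) by rewrite ff; ring.
apply: cvgB; last exact: (@cvg_cst R^o).
apply: cvgM; first exact: (@cvg_cst R^o).
exact: (L2cvg_inner f2 fn2 f2 cf).
Qed.

(** Triangle inequality without square roots: the right integrand exceeds the left one by (f + g - 2
    h)^2. *)
Lemma L2_dist_le f g h : L2 f -> L2 g -> L2 h ->
  \int[mu]_x ((f x - g x) ^+ 2) <=
  2 * \int[mu]_x ((f x - h x) ^+ 2) + 2 * \int[mu]_x ((g x - h x) ^+ 2).
Proof.
move=> f2 g2 h2; have [_ fh] := L2B f2 h2; have [_ gh] := L2B g2 h2.
rewrite -!RintegralTZ// -RintegralTD; [|exact: L1Z|exact: L1Z].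
apply: le_Rintegral => //.
- by have [] := L2B f2 g2.
- by apply: L1D; apply: L1Z.
- by move=> x _; have := sqr_ge0 (f x + g x - 2 * h x); nra.
Qed.

End L2.

Lemma L1_cst d (T : measurableType d) (R : realType)
  (mu : {finite_measure set T -> \bar R}) (k : R) : L1 mu (fun=> k).
Proof.
have mT : measurable (@setT T) by [].
exact: (@finite_measure_integrable_cst _ _ _ mu setT k).
Qed.

Lemma L2_le d (T : measurableType d) (R : realType) (mu : {measure set T -> \bar R})
  (f g : T -> R) : measurable_fun setT f -> (forall x, `|f x| <= `|g x|) ->
  L2 mu g -> L2 mu f.
Proof.
move=> mf fg [mg g2]; split => //; apply: L1_le g2; first exact: measurable_funX.
move=> x; rewrite ger0_norm ?sqr_ge0// -[leLHS]real_normK ?num_real//.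
by rewrite -[leRHS]real_normK ?num_real// ler_sqr ?nnegrE.
Qed.

(** * Product measures and independence *)

(** The inner integral in Fubini's theorem is finite only almost everywhere; [fine] sends its
    infinite values to 0, which changes it on a null set only. This transfers Fubini to real-valued
    integrals. *)
Lemma L1_fine d (T : measurableType d) (R : realType)
    (mu : {measure set T -> \bar R}) (F : T -> \bar R) :
  mu.-integrable setT F -> L1 mu (fun x => fine (F x)) /\
  \int[mu]_x fine (F x) = fine (\int[mu]_x F x)%E.
Proof.
move=> iF; have mF := measurable_int _ iF.
have mfine : measurable_fun setT (fun x => fine (F x)) by exact: measurableT_comp.
have fineF : ae_eq mu setT (fun x => (fine (F x))%:E) F.
  by have := integrable_ae measurableT iF; apply: filterS => x + _ => /(_ I)/fineK.
split; last first.
  by congr fine; apply: ae_eq_integral => //; exact/measurable_EFinP.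
apply: L1P => //; have /integrableP[_] := iF; apply: le_lt_trans.
rewrite le_eqVlt; apply/orP; left; apply/eqP.
apply: ge0_ae_eq_integral => //.
- by apply/measurable_EFinP; exact: measurableT_comp.
- exact: measurableT_comp.
- by apply: filterS fineF => x + _ => /(_ I) /= <-.
Qed.

Section product.
Context d1 d2 (T1 : measurableType d1) (T2 : measurableType d2) (R : realType).
Variable m1 : {sigma_finite_measure set T1 -> \bar R}.
Variable m2 : {sigma_finite_measure set T2 -> \bar R}.
Let pi : {measure set (T1 * T2) -> \bar R} := (m1 \x m2)%E.

Lemma L1_prodP (h : T1 * T2 -> R) : measurable_fun setT h ->
  (\int[m1]_x \int[m2]_y `|h (x, y)|%:E < +oo)%E -> L1 pi h.
Proof.
move=> mh hi; apply/(integrable12ltyP m1 m2) => //.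
exact/measurable_EFinP.
Qed.

Lemma Rfubini1 (h : T1 * T2 -> R) : L1 pi h ->
  L1 m1 (fun x => \int[m2]_y h (x, y)) /\
  \int[m1]_x (\int[m2]_y h (x, y)) = \int[pi]_z h z.
Proof.
move=> ih; have [I1 E1] := L1_fine (integrable_fubini_F ih).
by split => //; rewrite [LHS]E1 (integral12_prod_meas1 ih).
Qed.

Lemma integrable_fubini_G (f : T1 * T2 -> \bar R) :
  pi.-integrable setT f -> m2.-integrable setT (fubini_G m1 f).
Proof.
move=> If; have mf := measurable_int _ If.
apply/integrableP; split; first exact: (measurable_fubini_G If).
have mabs : measurable_fun setT (abse \o f) by exact: measurableT_comp.
apply: le_lt_trans ((integrable21ltyP m1 m2 mf).1 If).
apply: ge0_le_integral => //.
- by apply: measurableT_comp => //; exact: (measurable_fubini_G If).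
- by apply: (measurable_fun_fubini_tonelli_G (abse \o f)) => // x; exact: abse_ge0.
- by move=> y _; apply: le_abse_integral => //; exact: measurableT_comp.
Qed.

Lemma Rfubini2 (h : T1 * T2 -> R) : L1 pi h ->
  L1 m2 (fun y => \int[m1]_x h (x, y)) /\
  \int[m2]_y (\int[m1]_x h (x, y)) = \int[pi]_z h z.
Proof.
move=> ih; have [I2 E2] := L1_fine (integrable_fubini_G ih).
by split => //; rewrite [LHS]E2 (integral21_prod_meas1 ih).
Qed.

Lemma L1_tensor (f : T1 -> R) (g : T2 -> R) : L1 m1 f -> L1 m2 g ->
  L1 pi (fun z => f z.1 * g z.2).
Proof.
move=> If Ig; have mf := L1_measurable If; have mg := L1_measurable Ig.
have nf := integrable_norm If; have ng := integrable_norm Ig.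
apply: L1_prodP.
  by apply: measurable_funM; exact: measurableT_comp.
under eq_integral => x _.
  under eq_integral do rewrite /= normrM EFinM.
  rewrite ge0_integralZl//; last first.
    by apply/measurable_EFinP; exact: measurableT_comp.
  over.
rewrite ge0_integralZr//; last 2 first.
- by apply/measurable_EFinP; exact: measurableT_comp.
- exact: integral_ge0.
by rewrite lte_mul_pinfty//; [exact: integral_ge0|
  exact: integrable_fin_num|exact: integrable_lty].
Qed.

Lemma Rintegral_tensor (f : T1 -> R) (g : T2 -> R) : L1 m1 f -> L1 m2 g ->
  \int[pi]_z (f z.1 * g z.2) = \int[m1]_x f x * \int[m2]_y g y.
Proof.
move=> If Ig; have [_ <-] := Rfubini1 (L1_tensor If Ig).
rewrite -RintegralZr//; apply: eq_Rintegral => x _ /=.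
exact: RintegralTZ.
Qed.

Lemma L2_tensor (f : T1 -> R) (g : T2 -> R) : L2 m1 f -> L2 m2 g ->
  L2 pi (fun z => f z.1 * g z.2).
Proof.
move=> [mf If] [mg Ig]; split.
  by apply: measurable_funM; exact: measurableT_comp.
have -> : (fun z : T1 * T2 => (f z.1 * g z.2) ^+ 2) =
   (fun z => f z.1 ^+ 2 * g z.2 ^+ 2) by apply/funext => z; rewrite exprMn.
exact: (L1_tensor If Ig).
Qed.

End product.

Section independence.
Context d (T : measurableType d) (R : realType) (P : probability T R).
Variables X Y : T -> R.
Hypothesis XY : independent_systems P
  (preimage_set_system setT X measurable) (preimage_set_system setT Y measurable).

(** The law of (X, Y) agrees with the product of the two laws on rectangles, hence everywhere;
    Fubini for the product x y then separates the factors. *)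
Lemma independent_expectation_mul : L1 P X -> L1 P Y ->
  L1 P (fun w => X w * Y w) /\
  \int[P]_w (X w * Y w) = \int[P]_w X w * \int[P]_w Y w.
Proof.
move=> IX IY; have mX := L1_measurable IX; have mY := L1_measurable IY.
pose X' : {mfun T >-> R} := HB.pack X (isMeasurableFun.Build _ _ _ _ _ mX).
pose Y' : {mfun T >-> R} := HB.pack Y (isMeasurableFun.Build _ _ _ _ _ mY).
have mZ : measurable_fun setT (fun w => (X w, Y w)) by exact: measurable_fun_pair.
pose Z : {mfun T >-> (R * R)%type} :=
  HB.pack (fun w => (X w, Y w)) (isMeasurableFun.Build _ _ _ _ _ mZ).
have lawZ A : measurable A ->
    (distribution P X' \x distribution P Y')%E A = distribution P Z A.
  apply: product_measure_unique => B C mB mC.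
  apply: (XY (A := X @^-1` B) (B := Y @^-1` C)).
    by exists B => //; rewrite setTI.
  by exists C => //; rewrite setTI.
have law1 (V : {mfun T >-> R}) : L1 P V -> L1 (distribution P V) id.
  by move=> IV; apply: integrable_pushforward => //; exact/measurable_EFinP.
have law2 (V : {mfun T >-> R}) : L1 P V ->
    \int[distribution P V]_x x = \int[P]_w V w.
  by move=> IV; rewrite /Rintegral integral_distribution//; exact/measurable_EFinP.
have := L1_tensor (law1 X' IX) (law1 Y' IY).
have := Rintegral_tensor (law1 X' IX) (law1 Y' IY).
rewrite !law2// => E I2.
have mm : measurable_fun [set: R * R] (fun z : R * R => z.1 * z.2).
  exact: measurable_funM.
have meq f : (\int[(distribution P X' \x distribution P Y')%E]_z f z =
    \int[distribution P Z]_z f z)%E.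
  by apply: eq_measure_integral => A mA _; exact: lawZ.
have IZ : L1 P (fun w => X w * Y w).
  apply: L1P; first exact: measurable_funM.
  have /integrableP[_] := I2; rewrite meq ge0_integral_distribution//.
  by apply: measurableT_comp => //; exact/measurable_EFinP.
split => //; rewrite -E /Rintegral meq integral_distribution//.
exact/measurable_EFinP.
Qed.

End independence.

(** * Moments of the normal law *)

Section density.
Context d (T : measurableType d) (R : realType).
Variables (nu : {finite_measure set T -> \bar R}).
Variables (mu : {sigma_finite_measure set T -> \bar R}) (g : T -> R).
Hypotheses (g0 : forall x, 0 <= g x) (Ig : mu.-integrable setT (EFin \o g)).
Hypothesis nuE : forall A, measurable A -> nu A = (\int[mu]_(x in A) (g x)%:E)%E.

(** The change of variables holds with the Radon-Nikodym derivative of [nu], and [g] equals that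
    derivative almost everywhere, both having the same integral over every measurable set. *)
Lemma ge0_integral_density (f : T -> \bar R) :
  measurable_fun setT f -> (forall x, 0 <= f x)%E ->
  (\int[nu]_x f x = \int[mu]_x (f x * (g x)%:E))%E.
Proof.
move=> mf f0; have mg := measurable_int _ Ig.
have dom : nu `<< mu.
  apply/null_content_dominatesP => A mA muA; rewrite nuE//.
  by rewrite null_set_integral//; exact: measurable_funTS.
rewrite -(Radon_Nikodym_SigmaFinite.change_of_variables dom)//.
have Ih := Radon_Nikodym_SigmaFinite.f_integrable dom.
apply: ge0_ae_eq_integral => //.
- by apply: emeasurable_funM => //; exact: measurable_int Ih.
- exact: emeasurable_funM.
- by move=> x _; rewrite mule_ge0//; exact: Radon_Nikodym_SigmaFinite.f_ge0.
- by move=> x _; rewrite mule_ge0// lee_fin.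
- apply: ae_eqe_mul2l; apply: integral_ae_eq => // E _ mE.
  by rewrite -(Radon_Nikodym_SigmaFinite.f_integral dom)// nuE.
Qed.

End density.

Section normal_moments.
Context (R : realType).
Notation mu := (@lebesgue_measure R).
Variable s : R.
Hypothesis s0 : 0 < s.

Let p : R -> R := normal_pdf 0 s.

Let p_even x : p (- x) = p x.
Proof. by rewrite /p !normal_pdfE ?gt_eqF// /normal_fun !subr0 sqrrN. Qed.

(** Provides the antiderivative for integrating x * (x p x) by parts. *)
Let is_derive_p (x : R) : is_derive x 1 (fun y => - s ^+ 2 * p y) (x * p x).
Proof.
rewrite /p normal_pdfE ?gt_eqF// /normal_fun.
have E : is_derive x 1 (fun y : R => - (y - 0) ^+ 2 / (s ^+ 2 *+ 2)) (- x / s ^+ 2).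
  by apply: is_derive_eq; rewrite /GRing.scale/=; field; rewrite gt_eqF.
have E2 := is_derive1_comp (is_derive_expR _) E.
apply: is_derive_eq.
rewrite /GRing.scale/=; set c := normal_peak s; set e := expR _.
by field; rewrite gt_eqF.
Qed.

Let sn0 : s != 0. Proof. by rewrite gt_eqF. Qed.

Let p_ge0 x : 0 <= p x. Proof. exact: normal_pdf_ge0. Qed.

Let cont_p : continuous p. Proof. exact: continuous_normal_pdf. Qed.

Let mp : measurable_fun setT p. Proof. exact: measurable_normal_pdf. Qed.

Let half_p : (\int[mu]_(x in `[0%R, +oo[) (p x)%:E = (1 / 2)%:E)%E.
Proof.
have := integral_normal_pdf 0 s; rewrite -/p ge0_symfun_integralT//; last first.
  by move=> x; rewrite /= p_even.
rewrite -set_itvcy; set H := (\int[_]_(_ in _) _)%E.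
have : (0 <= H)%E by apply: integral_ge0 => x _; rewrite lee_fin.
case: H => [h|//|//] h0 /eqP.
- by rewrite -EFinM eqe => /eqP h2; congr EFin; lra.
- by rewrite mulry gtr0_sg// mul1e.
Qed.

(** The boundary term of the integration by parts vanishes at infinity. From y <= e^y with y = x^2 /
    (2 s^2) one gets x e^(-y) <= 2 s^2 / x, whence the constant [K]; the sequence is shifted to keep
    x positive. *)
Let xp_to0 : (s ^+ 2 * (n%:R * p n%:R)) @[n --> \oo] --> (0 : R).
Proof.
pose K := s ^+ 2 * normal_peak s * (2 * s ^+ 2).
rewrite -cvg_shiftS.
apply: (@squeeze_cvgr _ _ _ _ (cst 0) (fun n => K * n.+1%:R^-1)).
- near=> n; rewrite (mulr_ge0 (sqr_ge0 s))/= ?mulr_ge0//=.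
  rewrite /K -(mulrA (s ^+ 2 * _)) -(mulrA (s ^+ 2) (normal_peak s)).
  rewrite ler_pM2l ?exprn_gt0//.
  rewrite /p normal_pdfE// mulrCA ler_pM2l ?normal_peak_gt0//.
  rewrite /normal_fun subr0 mulNr expRN.
  set x : R := n.+1%:R; have x0 : 0 < x by rewrite ltr0n.
  set y := x ^+ 2 / _; have y0 : 0 < y.
    by rewrite divr_gt0 ?mulrn_wgt0 ?exprn_gt0.
  have H : y <= expR y by rewrite (le_trans _ (expR_ge1Dx _))// lerDr.
  apply: (@le_trans _ _ (x / y)).
    by rewrite ler_pM2l// lef_pV2// posrE expR_gt0.
  rewrite le_eqVlt; apply/orP; left; apply/eqP.
  by rewrite /y; field; rewrite !gt_eqF.
- exact: cvg_cst.
- rewrite -[X in _ --> X](mulr0 K); apply: cvgM; first exact: cvg_cst.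
  exact: cvg_harmonic.
Unshelve. all: by end_near. Qed.

(** On [0, n], parts give - s^2 n p(n) + s^2 int_0^n p, which tends to 0 + s^2 / 2; the left side
    tends to the integral over the half-line. *)
Let second_half :
  (\int[mu]_(x in `[0%R, +oo[) (x ^+ 2 * p x)%:E = (s ^+ 2 / 2)%:E)%E.
Proof.
have m2 : measurable_fun setT (fun x : R => x ^+ 2 * p x).
  by apply: measurable_funM => //; exact: measurable_funX.
have l2 := @ge0_cvgn_integral R mu (fun x => x ^+ 2 * p x)
  (fun x => mulr_ge0 (sqr_ge0 x) (p_ge0 x)) m2.
apply: (cvg_unique _ l2); first exact: ereal_hausdorff.
rewrite /=.
rewrite -(add0e (s ^+ 2 / 2)%:E).
have E : \forall n \near \oo,
    ((- (s ^+ 2 * (n%:R * p n%:R)))%:E +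
    (s ^+ 2)%:E * (\int[mu]_(x in `[0%R, n%:R]) (p x)%:E) =
    (\int[mu]_(x in `[0%R, n%:R]) (x ^+ 2 * p x)%:E))%E.
  exists 1%N => // n /= n1.
  have n0 : 0 < n%:R :> R by rewrite ltr0n.
  have ci : {within `[0, n%:R : R], continuous (fun _ : R => 1 : R)}.
    by apply: continuous_subspaceT => x; exact: cvg_cst.
  have cG : {within `[0, n%:R : R], continuous (fun x : R => x * p x)}.
    by apply: continuous_subspaceT => x; apply: cvgM; [exact: cvg_id|exact: cont_p].
  have dcont (F f : R -> R) : (forall x : R, is_derive x 1 F (f x)) ->
      derivable_oo_LRcontinuous F 0 n%:R.
    move=> dF; have cF x : {for x, continuous F}.
      by apply/differentiable_continuous/derivable1_diffP; case: (dF x).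
    split; first by move=> x _; case: (dF x).
      by apply: cvg_at_right_filter; exact: cF.
    by apply: cvg_at_left_filter; exact: cF.
  have := integration_by_parts n0 ci (dcont id _ (fun x : R => is_derive_id x 1)) _ cG
    (dcont _ _ is_derive_p) _.
  have -> : (fun x : R => (id x * (x * p x))%:E) = (fun x => (x ^+ 2 * p x)%:E).
    by apply/funext => x; rewrite mulrA expr2.
  move=> ->; last 2 first.
  - by move=> x _; rewrite derive1E derive_id.
  - by move=> x _; rewrite derive1E; case: (is_derive_p x).
  rewrite mul0r subr0.
  under [in RHS]eq_integral do rewrite mul1r EFinM.
  rewrite integralZl//; last first.
    apply: continuous_compact_integrable; first exact: segment_compact.
    exact: continuous_subspaceT.
  by rewrite (EFinN (s ^+ 2)) mulNe oppeK mulrCA mulNr mulrN.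
apply: cvg_trans; first exact: (near_eq_cvg E).
apply: cvgeD => //.
  rewrite -oppe0 -EFinN; apply: cvg_EFin; first exact: nearW.
  by apply: cvgN; exact: xp_to0.
have -> : (s ^+ 2 / 2)%:E = ((s ^+ 2)%:E * (\int[mu]_(x in `[0%R, +oo[) (p x)%:E))%E.
  by rewrite half_p -EFinM mul1r.
apply: cvgeZl => //.
exact: ge0_cvgn_integral.
Qed.

Lemma normal_second_moment :
  (\int[normal_prob 0 s]_x (x ^+ 2)%:E = (s ^+ 2)%:E)%E.
Proof.
rewrite (@ge0_integral_density _ _ _ (normal_prob 0 s) mu p)//; last 3 first.
- exact: integrable_normal_pdf.
- by apply/measurable_EFinP; exact: measurable_funX.
- by move=> x; rewrite lee_fin sqr_ge0.
under eq_integral do rewrite -EFinM.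
rewrite ge0_symfun_integralT; last 3 first.
- by move=> x; rewrite mulr_ge0// sqr_ge0.
- by move=> x; apply: cvgM ; [exact: exprn_continuous|exact: cont_p].
- by move=> x; rewrite /= sqrrN p_even.
by rewrite -set_itvcy second_half -EFinM; congr EFin; field.
Qed.

Lemma normal_L2 : L2 (normal_prob 0 s) id.
Proof.
split; first exact: measurable_id.
apply: L1P; first exact: measurable_funX.
under eq_integral do rewrite ger0_norm ?sqr_ge0//.
by rewrite normal_second_moment ltry.
Qed.

(** Both the Lebesgue measure and the centred density are invariant under x |-> - x. *)
Let integral_normalN (f : R -> \bar R) : measurable_fun setT f -> (forall x, 0 <= f x)%E ->
  (\int[normal_prob 0 s]_x f x = \int[normal_prob 0 s]_x f (- x)%R)%E.
Proof.
move=> mf f0; have mN : measurable_fun setT (-%R : R -> R) by exact: measurable_funN.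
have mN' :
  measurable_fun setT (-%R : measurableTypeR R -> measurableTypeR R) by [].
rewrite !(@ge0_integral_density _ _ _ (normal_prob 0 s) mu p)//; last 3 first.
- exact: integrable_normal_pdf.
- exact: measurableT_comp.
- exact: integrable_normal_pdf.
transitivity (\int[pushforward mu (-%R : R -> measurableTypeR R)]_x (f x * (p x)%:E))%E.
  by apply: eq_measure_integral => A mA _; exact/esym/lebesgue_measureN.
have mfp : measurable_fun setT (fun x => f x * (p x)%:E)%E.
  by apply: emeasurable_funM => //; exact/measurable_EFinP.
have fp0 x : (0 <= f x * (p x)%:E)%E by rewrite mule_ge0// lee_fin.
rewrite (ge0_integral_pushforward mN' mu measurableT mfp (fun x _ => fp0 x)).
by rewrite preimage_setT; apply: eq_integral => x _; rewrite /= p_even.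
Qed.

Lemma normal_mean : \int[normal_prob 0 s]_x x = 0.
Proof.
pose f (x : R) := x%:E; set N := normal_prob 0 s.
have E : (f^\- = (fun x : R => f^\+ (- x)%R))%E.
  by apply/funext => x; rewrite funenegE funeposE.
have mf : measurable_fun setT f by apply/measurable_EFinP; exact: measurable_id.
have EN : (\int[N]_x f^\- x = \int[N]_x f^\+ x)%E.
  by rewrite E -(@integral_normalN (f^\+)%E (measurable_funepos mf) (funepos_ge0 f)).
rewrite /Rintegral -[integral _ _ _]/(integral N setT f) integralE EN.
(* The positive and negative parts have equal integrals; were these infinite, [fine] of the
   difference would still be 0. *)
by case: (integral _ _ _) => [r| |] //=; rewrite subrr.
Qed.

End normal_moments.

(** * The filtration and the Wiener increments *)

Section measurable_wrt.
Context d (T : measurableType d) (R : realType).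
Implicit Types (G : set (set T)) (X Y : T -> R).

Lemma measurable_wrtP G X : measurable_wrt <<s G>> X <->
  measurable_fun (setT : set (g_sigma_algebraType G)) (X : g_sigma_algebraType G -> R).
Proof.
split=> [XG _ B mB|mX _ [B mB <-]]; last exact: mX.
by apply: XG; exists B.
Qed.

Lemma measurable_wrtM G X Y : measurable_wrt <<s G>> X ->
  measurable_wrt <<s G>> Y -> measurable_wrt <<s G>> (fun w => X w * Y w).
Proof.
move=> /measurable_wrtP mX /measurable_wrtP mY; apply/measurable_wrtP.
exact: measurable_funM.
Qed.

Lemma measurable_wrtB G X Y : measurable_wrt <<s G>> X ->
  measurable_wrt <<s G>> Y -> measurable_wrt <<s G>> (fun w => X w - Y w).
Proof.
move=> /measurable_wrtP mX /measurable_wrtP mY; apply/measurable_wrtP.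
exact: measurable_funB.
Qed.

Lemma measurable_wrtS G H X : G `<=` H -> measurable_wrt G X -> measurable_wrt H X.
Proof. by move=> GH XG; exact: subset_trans GH. Qed.

Lemma preimage_setI_closed X : setI_closed (preimage_set_system setT X measurable).
Proof.
move=> _ _ [A mA <-] [B mB <-]; exists (A `&` B); first exact: measurableI.
by rewrite !setTI preimage_setI.
Qed.

Lemma preimage_setT X : preimage_set_system setT X measurable setT.
Proof. by exists setT => //; rewrite setTI preimage_setT. Qed.

Lemma preimage_measurable X : measurable_fun setT X ->
  preimage_set_system setT X measurable `<=` measurable.
Proof. by move=> mX _ [B mB <-]; exact: mX. Qed.

End measurable_wrt.

Section independence_dynkin.
Context d (T : measurableType d) (R : realType) (P : probability T R).

(** For fixed C the finite measures A |-> P (A [&] C) and A |-> P C * P A agree on the pi-system G,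
    hence on the sigma-algebra that it generates. *)
Lemma independent_systems_dynkin (G H : set (set T)) : setI_closed G -> G setT ->
  G `<=` measurable -> H `<=` measurable ->
  independent_systems P G H -> independent_systems P <<s G>> H.
Proof.
move=> GI GT Gm Hm GH A C GA HC.
have mC := Hm _ HC.
have PC0 : 0 <= fine (P C) by rewrite fine_ge0.
pose m1 : {measure set T -> \bar R} := mrestr P mC.
pose m2 : {measure set T -> \bar R} := mscale (NngNum PC0) P.
have m2E E : m2 E = (P E * P C)%E.
  by rewrite /m2/= /mscale/= fineK ?fin_num_measure// muleC.
rewrite -m2E.
apply: (@g_sigma_algebra_measure_unique _ _ _ G Gm (fun=> setT) _ _ m1 m2) => //.
- by rewrite bigcup_const.
- by move=> E GE; rewrite m2E; exact: GH.
- by move=> k; rewrite /m1/= /mrestr setTI (le_lt_trans (probability_le1 _ _))// ltry.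
Qed.

End independence_dynkin.

Section filtration.
Context d (T : measurableType d) (R : realType) (P : probability T R).
Variables (W : R -> T -> R) (X0 : T -> R).
Hypotheses (hW : wiener_process P W) (mX0 : measurable_fun setT X0).
Hypothesis X0W : independent_of_process P X0 W.

Local Notation F := (augmented_filtration P X0 W).

Let mW t : 0 <= t -> measurable_fun setT (W t).
Proof. by case: hW => mW _ _ _ _; exact: mW. Qed.

Lemma filtration_measurable t : F t `<=` measurable.
Proof.
apply: smallest_sub; first exact: sigma_algebra_measurable.
move=> A [[|[u /=]]|[]//]; first exact: preimage_measurable.
by rewrite in_itv/= => /andP[u0 _]; apply: preimage_measurable; exact: mW.
Qed.

Lemma filtration_le s t : s <= t -> F s `<=` F t.
Proof.
move=> st; apply: sub_sigma_algebra2 => A [[|[u /= us]]|[]//].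
- by left; left.
- move=> WA; left; right; exists u => //=.
  by move: us; rewrite !in_itv/= => /andP[-> /le_trans]; exact.
- by right.
Qed.

Lemma filtration_wiener u t : 0 <= u -> u <= t -> measurable_wrt (F t) (W u).
Proof.
move=> u0 ut A WA; apply: sub_sigma_algebra; left; right; exists u => //=.
by rewrite in_itv/= u0.
Qed.

Lemma filtration_initial t : measurable_wrt (F t) X0.
Proof. by move=> A XA; apply: sub_sigma_algebra; left; left. Qed.

Let past_measurable s : sigma_past W s `<=` measurable.
Proof.
apply: smallest_sub; first exact: sigma_algebra_measurable.
move=> A [u /=]; rewrite in_itv/= => /andP[u0 _].
by apply: preimage_measurable; exact: mW.
Qed.

Let all_wiener u : 0 <= u -> measurable_wrt (sigma_all W) (W u).
Proof.
move=> u0 A WA; apply: sub_sigma_algebra; exists u => //=.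
by rewrite in_itv/= u0.
Qed.

(** The increment is given to be independent of the past of W only, whereas F s also contains X0 and
    the null sets. Independence is checked on a pi-system generating F s and then extended. *)
Lemma filtration_increment_independent s t : 0 <= s -> s < t ->
  independent_systems P (F s) (preimage_set_system setT (W t \- W s) measurable).
Proof.
move=> s0 st; have t0 : 0 <= t by rewrite (le_trans s0)// ltW.
have [_ _ _ indep _] := hW.
set D := preimage_set_system setT (W t \- W s) measurable.
have Dm : D `<=` measurable.
  apply: preimage_measurable; apply: measurable_funB; exact: mW.
have Dall : D `<=` sigma_all W.
  exact: (measurable_wrtB (all_wiener t0) (all_wiener s0)).
pose sX := preimage_set_system setT X0 measurable.
(* Intersections of an X0-event with a past event, plus the null sets: meeting a null set yields a
   null set, so G is stable under intersection. *)
pose G := [set E | (exists A B, [/\ sX A, sigma_past W s B & E = A `&` B]) \/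
  (measurable E /\ P E = 0%E)].
have Gm : G `<=` measurable.
  move=> E [[A [B [sA sB ->]]]|[]//]; apply: measurableI.
    exact: (preimage_measurable mX0 sA).
  exact: (past_measurable sB).
have nullI A N : measurable A -> measurable N -> P N = 0%E -> P (A `&` N) = 0%E.
  move=> mA mN N0; apply: (subset_measure0 _ mN) => //; exact: measurableI.
have pastI A B : sigma_past W s A -> sigma_past W s B -> sigma_past W s (A `&` B).
  exact: (@measurableI _ (g_sigma_algebraType
    (\bigcup_(u in `[0, s]) preimage_set_system setT (W u) measurable))).
have pastT : sigma_past W s setT.
  exact: (@measurableT _ (g_sigma_algebraType
    (\bigcup_(u in `[0, s]) preimage_set_system setT (W u) measurable))).
have GI : setI_closed G.
  move=> E E' GE GE'; have mE := Gm _ GE; have mE' := Gm _ GE'.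
  case: GE => [[A [B [sA sB ->]]]|[_ N0]]; last first.
    by right; split; [exact: measurableI|rewrite setIC nullI].
  case: GE' mE' => [[A' [B' [sA' sB' ->]]]|[_ N0]] mE'; last first.
    right; split; first by apply: measurableI => //; apply: Gm; left; exists A, B.
    by rewrite nullI//; apply: Gm; left; exists A, B.
  left; exists (A `&` A'), (B `&` B'); split.
  - exact: preimage_setI_closed.
  - exact: pastI.
  - by rewrite setIACA.
have GT : G setT.
  left; exists setT, setT; split => //; last by rewrite setIT.
  exact: preimage_setT.
have sub : F s `<=` <<s G>>.
  apply: sub_sigma_algebra2 => A [[XA|WA]|]; last by right.
  - by left; exists A, setT; split => //; rewrite setIT.
  - left; exists setT, A; split => //; last by rewrite setTI.
      exact: preimage_setT.
    exact: sub_sigma_algebra.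
suff : independent_systems P <<s G>> D by move=> H A B /sub; exact: H.
apply: independent_systems_dynkin => // E C [[A [B [sA sB ->]]]|[mE E0]] DC.
- have Ball : sigma_all W B.
    apply: sub_sigma_algebra2 sB => V [u /=]; rewrite in_itv/= => /andP[u0 _] Vu.
    by exists u => //=; rewrite in_itv/= u0.
  have BCall : sigma_all W (B `&` C).
    apply: (@measurableI _ (g_sigma_algebraType
      (\bigcup_(u in `[0, +oo[) preimage_set_system setT (W u) measurable))) => //.
    exact: Dall.
  (* Since B and C both belong to the sigma-algebra of all of W, P (A B C) = P A P (B C), and X0
     splits off; independence of increments then separates B from C. *)
  rewrite -setIA X0W// [in RHS]X0W// -muleA; congr (_ * _)%E.
  by rewrite setIC (indep s t)// muleC.
- by rewrite E0 mul0e setIC nullI//; exact: Dm.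
Qed.

End filtration.

Section law.
Context d (T : measurableType d) (R : realType) (P : probability T R).
Variables (X : T -> measurableTypeR R) (mX : measurable_fun setT X).
Variable N : {measure set (measurableTypeR R) -> \bar R}.
Hypothesis XN : forall B, measurable B -> P (X @^-1` B) = N B.

Lemma L1_law (f : measurableTypeR R -> R) : L1 N f ->
  L1 P (fun w => f (X w)) /\ \int[P]_w f (X w) = \int[N]_x f x.
Proof.
move=> If; have mf := measurable_int _ If.
pose X' : {mfun T >-> measurableTypeR R} :=
  HB.pack X (isMeasurableFun.Build _ _ _ _ _ mX).
have lawE (g : measurableTypeR R -> \bar R) :
    (\int[distribution P X']_x g x = \int[N]_x g x)%E.
  by apply: eq_measure_integral => A mA _; exact: XN.
have IX : L1 P (fun w => f (X w)).
  apply: L1P; first by apply: measurableT_comp => //; exact/measurable_EFinP.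
  have /integrableP[_] := If; rewrite -lawE ge0_integral_distribution//.
  exact: measurableT_comp.
by split => //; rewrite /Rintegral -lawE integral_distribution.
Qed.

End law.

Section increments.
Context d (T : measurableType d) (R : realType) (P : probability T R).
Variables (W : R -> T -> R) (X0 : T -> R).
Hypotheses (hW : wiener_process P W) (mX0 : measurable_fun setT X0).
Hypothesis X0W : independent_of_process P X0 W.

Local Notation F := (augmented_filtration P X0 W).
Local Notation D u v := (fun w => W v w - W u w).

Let mD u v : 0 <= u -> u <= v -> measurable_fun setT (D u v).
Proof.
case: hW => mW _ _ _ _ u0 uv.
by apply: measurable_funB; apply: mW => //; exact: le_trans uv.
Qed.

Lemma increment_moments u v : 0 <= u -> u <= v ->
  [/\ L2 P (D u v), \int[P]_w (W v w - W u w) = 0 &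
      \int[P]_w ((W v w - W u w) ^+ 2) = v - u].
Proof.
(* The normal law is prescribed for u < v only; for u = v the increment is identically 0. *)
move=> u0; rewrite le_eqVlt => /predU1P[->|uv].
  have E : (fun w => W v w - W v w) = (fun=> 0) by apply/funext => w; rewrite subrr.
  have E2 : (fun w => (W v w - W v w) ^+ 2) = (fun=> 0).
    by apply/funext => w; rewrite subrr expr0n.
  by rewrite E E2 subrr /Rintegral integral0; split => //; exact: L2_0.
have vu : 0 < v - u by rewrite subr_gt0.
have [_ _ law _ _] := hW.
have m := mD u0 (ltW uv).
have s0 : 0 < Num.sqrt (v - u) by rewrite sqrtr_gt0.
have [mid I2] := normal_L2 s0.
have lawN := @L1_law _ _ _ P (D u v) m (normal_prob 0 (Num.sqrt (v - u)))
  (fun B mB => law u v u0 uv B mB).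
have I1 : L1 (normal_prob 0 (Num.sqrt (v - u))) (id : measurableTypeR R -> R).
  apply: (@L1_le _ _ _ _ _ (fun x : measurableTypeR R => 1 + (x : R) ^+ 2)).
  - exact: measurable_id.
  - by move=> x; rewrite ler_norml; apply/andP; split; nra.
  - by apply: L1D => //; exact: L1_cst.
have [J2 E2] := lawN _ I2; have [J1 E1] := lawN _ I1.
split => //.
- by rewrite E1 normal_mean.
- by rewrite E2 /Rintegral normal_second_moment//= sqr_sqrtr// ltW.
Qed.

Let indep u v (Z : T -> R) (f : R -> R) : 0 <= u -> u < v -> measurable_wrt (F u) Z ->
  measurable_fun setT f ->
  independent_systems P (preimage_set_system setT Z measurable)
    (preimage_set_system setT (fun w => f (W v w - W u w)) measurable).
Proof.
move=> u0 uv mZ mf A B ZA [C mC <-].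
apply: (filtration_increment_independent hW mX0 X0W u0 uv); first exact: mZ.
exists (f @^-1` C) => //; rewrite -[X in measurable X]setTI; exact: mf.
Qed.

Lemma increment_mul u v (Z : T -> R) : 0 <= u -> u <= v ->
  L1 P Z -> measurable_wrt (F u) Z ->
  L1 P (fun w => Z w * (W v w - W u w)) /\ \int[P]_w (Z w * (W v w - W u w)) = 0.
Proof.
move=> u0; rewrite le_eqVlt => /predU1P[->|uv] IZ mZ.
  have -> : (fun w => Z w * (W v w - W v w)) = (fun=> 0).
    by apply/funext => w; rewrite subrr mulr0.
  by rewrite /Rintegral integral0; split => //; exact: integrable0.
have [D2 D0 _] := increment_moments u0 (ltW uv).
have I1 : L1 P (D u v).
  have [m1 J2] := D2.
  apply: (@L1_le _ _ _ _ _ (fun w => 1 + (W v w - W u w) ^+ 2)) => //.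
  - by move=> x; set y := W v x - W u x; rewrite ler_norml; apply/andP; split; nra.
  - by apply: L1D => //; exact: L1_cst.
have [J E] := independent_expectation_mul
  (indep u0 uv mZ (@measurable_id _ _ setT)) IZ I1.
by split => //; rewrite E D0 mulr0.
Qed.

Lemma increment_mul_sqr u v (Z : T -> R) : 0 <= u -> u <= v ->
  L1 P Z -> measurable_wrt (F u) Z ->
  L1 P (fun w => Z w * (W v w - W u w) ^+ 2) /\
  \int[P]_w (Z w * (W v w - W u w) ^+ 2) = (v - u) * \int[P]_w Z w.
Proof.
move=> u0; rewrite le_eqVlt => /predU1P[->|uv] IZ mZ.
  have -> : (fun w => Z w * (W v w - W v w) ^+ 2) = (fun=> 0).
    by apply/funext => w; rewrite subrr expr0n mulr0.
  rewrite /Rintegral integral0 subrr mul0r; split => //; exact: integrable0.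
have [D2 _ DE] := increment_moments u0 (ltW uv).
have msq : measurable_fun setT (fun x : R => x ^+ 2) by exact: measurable_funX.
have [J E] := independent_expectation_mul (indep u0 uv mZ msq) IZ D2.2.
by split => //; rewrite E DE mulrC.
Qed.

(** A product of two L^2 functions is in general only L^1; here e^2 and the squared increment are
    integrable and independent, so their product is integrable. *)
Lemma step_L2 u v (e : T -> R) : 0 <= u -> u <= v ->
  L2 P e -> measurable_wrt (F u) e ->
  L2 P (fun w => e w * (W v w - W u w)).
Proof.
move=> u0 uv [me e2] eF; split; first by apply: measurable_funM => //; exact: mD.
have -> : (fun w => (e w * (W v w - W u w)) ^+ 2) =
    (fun w => (e w * e w) * (W v w - W u w) ^+ 2) by apply/funext => w; ring.
have ee : L1 P (fun w => e w * e w).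
  by move: e2; under [X in L1 P X -> _]eq_fun do rewrite expr2.
have [] // := increment_mul_sqr u0 uv ee.
exact: measurable_wrtM.
Qed.

Lemma step_orthogonal u v (Z e : T -> R) : 0 <= u -> u <= v -> L2 P e -> L2 P Z ->
  measurable_wrt (F u) e -> measurable_wrt (F u) Z ->
  \int[P]_w (Z w * (e w * (W v w - W u w))) = 0.
Proof.
move=> u0 uv e2 Z2 eF ZF.
have [_ <-] := increment_mul u0 uv (L2_mul Z2 e2) (measurable_wrtM ZF eF).
by apply: eq_Rintegral => w _; rewrite mulrA.
Qed.

(** Split the longer increment at v: its part after v is orthogonal to everything known at time v,
    and the common part gives the factor v - u by independence. *)
Let step_pair_same u v v' (e e' : T -> R) : 0 <= u -> u <= v -> v <= v' ->
  L2 P e -> L2 P e' -> measurable_wrt (F u) e -> measurable_wrt (F u) e' ->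
  \int[P]_w ((e w * (W v w - W u w)) * (e' w * (W v' w - W u w))) =
  (v - u) * \int[P]_w (e w * e' w).
Proof.
move=> u0 uv vv' e2 e2' eF eF'; have v0 := le_trans u0 uv.
have eDF : measurable_wrt (F v) (fun w => e w * (W v w - W u w)).
  have Fuv : F u `<=` F v by exact: filtration_le.
  apply: measurable_wrtM; first exact: measurable_wrtS eF.
  by apply: measurable_wrtB; exact: filtration_wiener.
have eF'v : measurable_wrt (F v) e' by apply: measurable_wrtS eF'; exact: filtration_le.
have := step_orthogonal v0 vv' e2' (step_L2 u0 uv e2 eF) eF'v eDF.
have [I1 E1] := increment_mul_sqr u0 uv (L2_mul e2 e2') (measurable_wrtM eF eF').
have I2 : L1 P (fun w => (e w * (W v w - W u w)) * (e' w * (W v' w - W v w))).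
  by apply: L2_mul; apply: step_L2.
rewrite -E1 => E2; rewrite -[RHS]addr0 -E2 -RintegralTD//.
by apply: eq_Rintegral => w _; ring.
Qed.

(* The first factor is the length of the overlap of [u, v[ and [u', v'[. *)
Lemma step_pair u v u' v' (e e' : T -> R) :
  0 <= u -> u <= v -> 0 <= u' -> u' <= v' ->
  L2 P e -> L2 P e' -> measurable_wrt (F u) e -> measurable_wrt (F u') e' ->
  \int[P]_w ((e w * (W v w - W u w)) * (e' w * (W v' w - W u' w))) =
  Num.max 0 (Num.min v v' - Num.max u u') * \int[P]_w (e w * e' w).
Proof.
wlog uu' : u v u' v' e e' / u <= u'.
  move=> H; have /orP[uu'|u'u] := le_total u u'; first exact: (H _ _ _ _ _ _ uu').
  move=> u0 uv u0' uv' e2 e2' eF eF'.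
  have := H _ _ _ _ _ _ u'u u0' uv' u0 uv e2' e2 eF' eF.
  rewrite (minC v') (maxC u') (_ : \int[P]_w (e' w * e w) = \int[P]_w (e w * e' w)).
    by move=> <-; apply: eq_Rintegral => w _; rewrite mulrC.
  by apply: eq_Rintegral => w _; rewrite mulrC.
move=> u0 uv u0' uv' e2 e2' eF eF'.
(* The step on [u, v[ is cut at u' into [u, p[ and [u', q[, one of them possibly empty. The first
   piece is known at u' and so orthogonal to the other step; the second starts together with it,
   which is the case already settled. *)
pose p := Num.min v u'; pose q := Num.max v u'.
have WE w : W v w - W u w = (W p w - W u w) + (W q w - W u' w).
  by rewrite /p /q; case: (leP v u') => _; ring.
have up : u <= p by rewrite le_min uv.
have pu' : p <= u' by rewrite ge_min lexx orbT.
have u'q : u' <= q by rewrite le_max lexx orbT.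
have p0 := le_trans u0 up.
have eF2 : measurable_wrt (F u') e by apply: measurable_wrtS eF; exact: filtration_le.
have L2p := step_L2 u0 up e2 eF.
have L2q := step_L2 u0' u'q e2 eF2.
have L2v' := step_L2 u0' uv' e2' eF'.
have ePF : measurable_wrt (F u') (fun w => e w * (W p w - W u w)).
  by apply: measurable_wrtM => //; apply: measurable_wrtB; exact: filtration_wiener.
have E1 := step_orthogonal u0' uv' e2' L2p eF' ePF.
have E2 : \int[P]_w ((e w * (W q w - W u' w)) * (e' w * (W v' w - W u' w))) =
   Num.max 0 (Num.min v v' - Num.max u u') * \int[P]_w (e w * e' w).
  rewrite (max_r uu').
  have [qv'|/ltW v'q] := leP q v'.
    have vv' : v <= v' by rewrite (le_trans _ qv')// /q le_max lexx.
    rewrite step_pair_same//; congr (_ * _); rewrite (min_l vv') /q.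
    case: (leP v u') => vu'; first by rewrite subrr max_l// subr_le0.
    by rewrite max_r// subr_ge0 ltW.
  transitivity (\int[P]_w ((e' w * (W v' w - W u' w)) * (e w * (W q w - W u' w)))).
    by apply: eq_Rintegral => w _; rewrite mulrC.
  rewrite step_pair_same//.
  rewrite (_ : \int[P]_w (e' w * e w) = \int[P]_w (e w * e' w)); last first.
    by apply: eq_Rintegral => w _; rewrite mulrC.
  congr (_ * _); move: v'q; rewrite /q; case: (leP v u') => vu' v'q.
    have -> : v' = u' by apply/eqP; rewrite eq_le uv' v'q.
    by rewrite (min_l vu') subrr max_l// subr_le0.
  by rewrite (min_r v'q) max_r// subr_ge0.
rewrite -E2 -[RHS]add0r -E1 -RintegralTD; [|exact: L2_mul|exact: L2_mul].
by apply: eq_Rintegral => w _; rewrite WE; ring.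
Qed.

End increments.

(** * Isometry for simple processes *)

Section simple_isometry.
Context d (T : measurableType d) (R : realType) (P : probability T R).
Variables (W : R -> T -> R) (X0 : T -> R).
Hypotheses (hW : wiener_process P W) (mX0 : measurable_fun setT X0).
Hypothesis X0W : independent_of_process P X0 W.

Local Notation F := (augmented_filtration P X0 W).
Local Notation leb := (@lebesgue_measure R).
Local Notation pi := (leb \x P)%E.

Lemma RintegralT_indic_itv (a b : R) :
  \int[leb]_x \1_(`[a, b[%classic) x = Num.max 0 (b - a).
Proof.
rewrite /Rintegral integral_indic// setIT /= lebesgue_measure_itv/= lte_fin.
case: (ltP a b) => [ab|ba] /=; first by rewrite max_r// subr_ge0 ltW.
by rewrite max_l// subr_le0.
Qed.

Lemma L1_indic_itv (a b : R) : L1 leb (\1_(`[a, b[%classic)).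
Proof. exact: integrable_indic_itv. Qed.

Definition step_process (s u v : R) (e : T -> R) (z : measurableTypeR R * T) : R :=
  \1_(`[0, s[%classic) z.1 * \1_(`[u, v[%classic) z.1 * e z.2.

Lemma indic_itvM (a b a' b' x : R) :
  \1_(`[a, b[%classic) x * \1_(`[a', b'[%classic) x =
  \1_(`[Num.max a a', Num.min b b'[%classic) x :> R.
Proof.
rewrite !indicE -natrM mulnb; congr (_%:R); congr nat_of_bool.
apply/andP/idP; rewrite !inE /= !in_itv/= ?ge_max ?lt_min.
  by move=> [/andP[-> ->] /andP[-> ->]].
by move=> /andP[/andP[-> ->] /andP[-> ->]].
Qed.

Lemma step_processE s u v e z : 0 <= u -> step_process s u v e z =
  \1_(`[u, Num.min s v[%classic) z.1 * e z.2.
Proof. by move=> u0; rewrite /step_process indic_itvM (max_r u0). Qed.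

Lemma step_process_L2 s u v e : 0 <= u -> L2 P e -> L2 pi (step_process s u v e).
Proof.
move=> u0 e2.
have -> : step_process s u v e =
    (fun z => \1_(`[u, Num.min s v[%classic) z.1 * e z.2).
  by apply/funext => z; exact: step_processE.
apply: L2_tensor => //; split; first exact: measurable_indic.
have -> : (fun x : measurableTypeR R => \1_(`[u, Num.min s v[%classic) x ^+ 2) =
    \1_(`[u, Num.min s v[%classic) :> (R -> R).
  by apply/funext => x; rewrite expr2 indic_itvM maxxx minxx.
exact: L1_indic_itv.
Qed.

Lemma step_process_inner s u v u' v' (e e' : T -> R) : 0 <= u -> 0 <= u' ->
  L2 P e -> L2 P e' ->
  \int[pi]_z (step_process s u v e z * step_process s u' v' e' z) =
  Num.max 0 (Num.min s (Num.min v v') - Num.max u u') * \int[P]_w (e w * e' w).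
Proof.
move=> u0 u0' e2 e2'.
have -> : (fun z => step_process s u v e z * step_process s u' v' e' z) =
    (fun z => \1_(`[Num.max u u', Num.min s (Num.min v v')[%classic) z.1 *
              (e z.2 * e' z.2)).
  apply/funext => z; rewrite !step_processE// mulrACA indic_itvM.
  by rewrite minACA minxx.
rewrite (Rintegral_tensor (L1_indic_itv _ _) (L2_mul e2 e2')).
by rewrite RintegralT_indic_itv.
Qed.

(** Stopping both endpoints at s gives the integral over [0, s] of a step that may extend beyond s.
    Integrals at an earlier time are thus obtained without building a new simple process. *)
Definition step_integral (s u v : R) (e : T -> R) (w : T) : R :=
  e w * (W (Num.min v s) w - W (Num.min u s) w).

Lemma step_integral_ge s u v e : s <= u -> u <= v ->
  step_integral s u v e = fun=> 0.
Proof.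
move=> su uv; apply/funext => w; rewrite /step_integral (min_r su).
by rewrite (min_r (le_trans su uv)) subrr mulr0.
Qed.

Lemma step_integral_L2 s u v e : 0 <= u -> u <= v ->
  L2 P e -> measurable_wrt (F u) e -> L2 P (step_integral s u v e).
Proof.
move=> u0 uv e2 eF; have [su|us] := leP s u.
  by rewrite step_integral_ge//; exact: L2_0.
rewrite /step_integral (min_l (ltW us)).
by apply: (step_L2 hW mX0 X0W) => //; rewrite le_min uv ltW.
Qed.

(** Both sides equal the length of the overlap of the two steps before time s, times E (e e'); a
    step starting after s contributes 0 to either side. *)
Lemma step_integral_inner s u v u' v' (e e' : T -> R) :
  0 <= u -> u <= v -> 0 <= u' -> u' <= v' ->
  L2 P e -> L2 P e' -> measurable_wrt (F u) e -> measurable_wrt (F u') e' ->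
  \int[P]_w (step_integral s u v e w * step_integral s u' v' e' w) =
  \int[pi]_z (step_process s u v e z * step_process s u' v' e' z).
Proof.
move=> u0 uv u0' uv' e2 e2' eF eF'; rewrite step_process_inner//.
have [su|us] := leP s u.
  rewrite step_integral_ge//; under eq_Rintegral do rewrite mul0r.
  rewrite [LHS]/Rintegral integral0 max_l ?mul0r// subr_le0.
  by rewrite le_max ge_min su.
have [su'|us'] := leP s u'.
  rewrite (step_integral_ge _ su' uv'); under eq_Rintegral do rewrite mulr0.
  rewrite [LHS]/Rintegral integral0 max_l ?mul0r// subr_le0.
  by rewrite le_max !ge_min su' orbT.
rewrite /step_integral (min_l (ltW us)) (min_l (ltW us')).
rewrite (step_pair hW mX0 X0W)//; last 2 first.
- by rewrite le_min uv ltW.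
- by rewrite le_min uv' ltW.
by rewrite minACA minxx [in RHS]minC.
Qed.

(** The intervals may overlap and come in any order, so that simple processes with different
    partitions can be compared without a common refinement. *)
Definition adapted_steps (I : finType) (u v : I -> R) (e : I -> T -> R) :=
  forall i, [/\ 0 <= u i, u i <= v i, L2 P (e i) & measurable_wrt (F (u i)) (e i)].

Section sums.
Variables (I : finType) (u v : I -> R) (e : I -> T -> R).
Hypothesis ue : adapted_steps u v e.

Definition steps_process s z := \sum_i step_process s (u i) (v i) (e i) z.
Definition steps_integral s w := \sum_i step_integral s (u i) (v i) (e i) w.

Lemma steps_process_L2 s : L2 pi (steps_process s).
Proof. by apply: L2_sum => i; case: (ue i) => *; exact: step_process_L2. Qed.

Lemma steps_integral_L2 s : L2 P (steps_integral s).
Proof. by apply: L2_sum => i; case: (ue i) => *; exact: step_integral_L2. Qed.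

Lemma steps_integral_martingale s t (G : T -> R) : 0 <= s -> s <= t ->
  (forall i, v i <= t) -> L2 P G -> measurable_wrt (F s) G ->
  \int[P]_w (G w * steps_integral t w) = \int[P]_w (G w * steps_integral s w).
Proof.
move=> s0 st vt G2 GF; have t0 := le_trans s0 st.
have GL r i : L1 P (fun w => G w * step_integral r (u i) (v i) (e i) w).
  by case: (ue i) => *; apply: L2_mul => //; exact: step_integral_L2.
rewrite /steps_integral.
under eq_Rintegral do rewrite mulr_sumr.
under [in RHS]eq_Rintegral do rewrite mulr_sumr.
rewrite !RintegralT_sum//; apply: eq_bigr => i _.
have [u0 uv e2 eF] := ue i.
apply/eqP; rewrite -subr_eq0 -RintegralTB//; apply/eqP.
(* What a single step gains between s and t is [e] times the increment of W over [a, b]; at time a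
   >= s both G and e are known, hence orthogonality. *)
pose a := Num.max (u i) s; pose b := Num.max (v i) s.
have a0 : 0 <= a by rewrite le_max u0.
have ab : a <= b by rewrite ge_max !le_max uv lexx orbT.
have eFa : measurable_wrt (F a) (e i).
  by apply: measurable_wrtS eF; apply: filtration_le; rewrite le_max lexx.
have GFa : measurable_wrt (F a) G.
  by apply: measurable_wrtS GF; apply: filtration_le; rewrite le_max lexx orbT.
rewrite -(step_orthogonal hW mX0 X0W a0 ab e2 G2 eFa GFa).
apply: eq_Rintegral => w _; rewrite -mulrBr /step_integral -mulrBr.
congr (_ * (_ * _)); rewrite (min_l (vt i)) (min_l (le_trans uv (vt i))) /a /b.
by case: (leP (u i) s) => _; case: (leP (v i) s) => _; ring.
Qed.

End sums.

Lemma steps_isometry (I J : finType) (u v : I -> R) (e : I -> T -> R)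
    (u' v' : J -> R) (e' : J -> T -> R) s :
  adapted_steps u v e -> adapted_steps u' v' e' ->
  \int[P]_w (steps_integral u v e s w * steps_integral u' v' e' s w) =
  \int[pi]_z (steps_process u v e s z * steps_process u' v' e' s z).
Proof.
move=> ue ue'; rewrite /steps_integral /steps_process.
under eq_Rintegral do rewrite mulr_suml.
under [in RHS]eq_Rintegral do rewrite mulr_suml.
have L i j : L1 P (fun w => step_integral s (u i) (v i) (e i) w *
                            step_integral s (u' j) (v' j) (e' j) w).
  case: (ue i) => u0 uv e2 eF; case: (ue' j) => u0' uv' e2' eF'.
  by apply: L2_mul; exact: step_integral_L2.
have L' i j : L1 pi (fun z => step_process s (u i) (v i) (e i) z *
                            step_process s (u' j) (v' j) (e' j) z).
  case: (ue i) => u0 uv e2 eF; case: (ue' j) => u0' uv' e2' eF'.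
  by apply: L2_mul; exact: step_process_L2.
rewrite !RintegralT_sum; last 2 first.
- by move=> i; under eq_fun do rewrite mulr_sumr; exact: L1_sum.
- by move=> i; under eq_fun do rewrite mulr_sumr; exact: L1_sum.
apply: eq_bigr => i _.
under eq_Rintegral do rewrite mulr_sumr.
under [in RHS]eq_Rintegral do rewrite mulr_sumr.
rewrite !RintegralT_sum//; apply: eq_bigr => j _.
case: (ue i) => u0 uv e2 eF; case: (ue' j) => u0' uv' e2' eF'.
exact: step_integral_inner.
Qed.

(** Expanding both squares leaves three inner products, each covered by the isometry for pairs of
    families. *)
Lemma steps_isometry_dist (I J : finType) (u v : I -> R) (e : I -> T -> R)
    (u' v' : J -> R) (e' : J -> T -> R) s :
  adapted_steps u v e -> adapted_steps u' v' e' ->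
  \int[P]_w ((steps_integral u v e s w - steps_integral u' v' e' s w) ^+ 2) =
  \int[pi]_z ((steps_process u v e s z - steps_process u' v' e' s z) ^+ 2).
Proof.
move=> ue ue'.
have E d' (T' : measurableType d') (mu : {measure set T' -> \bar R}) f g :
    L2 mu f -> L2 mu g -> \int[mu]_x ((f x - g x) ^+ 2) =
    \int[mu]_x (f x * f x) - 2 * \int[mu]_x (f x * g x) + \int[mu]_x (g x * g x).
  move=> f2 g2; have ff := L2_mul f2 f2; have fg := L2_mul f2 g2.
  have gg := L2_mul g2 g2; have fg2 := L1Z 2 fg; have Iff := L1B ff fg2.
  rewrite -RintegralTZ// -RintegralTB// -RintegralTD//.
  by apply: eq_Rintegral => x _; ring.
have i2 := steps_integral_L2 ue s; have i2' := steps_integral_L2 ue' s.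
have p2 := steps_process_L2 ue s; have p2' := steps_process_L2 ue' s.
by rewrite (E _ _ P)// (E _ _ pi)// !steps_isometry.
Qed.

End simple_isometry.

(** * The Ito integral *)

Section second_moment.
Context d (T : measurableType d) (R : realType) (P : probability T R).

Lemma second_momentE (X : T -> R) : second_moment P X = (\int[P]_w (X w ^+ 2)%:E)%E.
Proof.
rewrite /second_moment unlock; apply: eq_integral => w _.
by rewrite real_normK// num_real.
Qed.

Lemma square_integrableP (X : T -> R) : square_integrable P X <-> L2 P X.
Proof.
rewrite /square_integrable second_momentE; split=> -[mX IX]; split => //.
  apply: L1P; first exact: measurable_funX.
  by under eq_integral do rewrite ger0_norm ?sqr_ge0//.
have /integrableP[_] := IX.
by under eq_integral do rewrite /= ger0_norm ?sqr_ge0//.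
Qed.

Lemma second_moment_fine (X : T -> R) : L2 P X ->
  second_moment P X = (\int[P]_w (X w ^+ 2))%:E.
Proof. by move=> X2; rewrite second_momentE EFin_RintegralT//; case: X2. Qed.

End second_moment.

Section cut.
Context d (T : measurableType d) (R : realType) (P : probability T R).
Local Notation leb := (@lebesgue_measure R).
Local Notation pi := (leb \x P)%E.

(* Half-open, so that cutting a step process gives a step process; the energy
   does not see the endpoint. *)
Definition cut (t : R) (H : R -> T -> R) (z : measurableTypeR R * T) : R :=
  \1_(`[0, t[%classic) z.1 * H z.1 z.2.

Lemma cut_measurable (t : R) (H : R -> T -> R) :
  measurable_fun (`[0, t] `*` setT) (fun p : R * T => H p.1 p.2) ->
  measurable_fun setT (cut t H).
Proof.
move=> mH.
have -> : cut t H = (fun p : R * T => H p.1 p.2) \_ (`[0, t[ `*` setT).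
  apply/funext => -[s w]; rewrite /cut patchE /= indicE.
  have -> : ((s, w) \in `[0, t[ `*` setT) = (s \in `[0, t[%classic).
    by apply/idP/idP; rewrite !inE/=; [case|].
  by case: ifP; rewrite ?mul1r ?mul0r.
apply/(measurable_restrictT _ _).1 => //; first exact: measurableX.
apply: measurable_funS mH; first exact: measurableX.
by move=> [s w] [/= st _]; split => //=; apply: subset_itv_co_cc st.
Qed.

(** Tonelli, with the endpoint t discarded as a null set. Joint measurability is assumed on [0, t]
    only, and extension by 0 makes the integrand measurable on the whole product. *)
Lemma energyE (t : R) (H : R -> T -> R) :
  measurable_fun (`[0, t] `*` setT) (fun p : R * T => H p.1 p.2) ->
  energy P H t = (\int[pi]_z (cut t H z ^+ 2)%:E)%E.
Proof.
move=> mH; have mc := cut_measurable mH.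
rewrite fubini_tonelli2//; last 2 first.
- by apply/measurable_EFinP; exact: measurable_funX.
- by move=> z; rewrite lee_fin sqr_ge0.
apply: eq_integral => w _.
have cutE : (fun s : R => (cut t H (s, w) ^+ 2)%:E) =
    (fun s => (`|H s w| ^+ 2)%:E) \_ `[0%R, t[.
  apply/funext => s; rewrite /cut/= patchE indicE.
  by case: ifP => _; rewrite ?mul1r ?mul0r ?expr0n// real_normK// num_real.
rewrite /fubini_G cutE -integral_mkcond integral_itv_bndo_bndc//.
apply/(measurable_restrictT _ _).2 => //; rewrite -cutE.
apply/measurable_EFinP; apply: measurable_funX.
exact: (measurableT_comp mc (pair2_measurable w)).
Qed.

Lemma cut_L2 F (H : R -> T -> R) (t : R) : ito_integrand P F H t -> L2 pi (cut t H).
Proof.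
move=> [mH _ He]; have mc := cut_measurable mH; split => //.
apply: L1P; first exact: measurable_funX.
by under eq_integral do rewrite ger0_norm ?sqr_ge0//; rewrite -energyE.
Qed.

End cut.

Section ito_integral.
Context d (T : measurableType d) (R : realType) (P : probability T R).
Variables (W : R -> T -> R) (X0 : T -> R).
Hypotheses (hW : wiener_process P W) (mX0 : measurable_fun setT X0).
Hypothesis X0W : independent_of_process P X0 W.

Local Notation F := (augmented_filtration P X0 W).
Local Notation leb := (@lebesgue_measure R).
Local Notation pi := (leb \x P)%E.

Section simple.
Variables (t : R) (h : simple_process P F t).

Let u (i : 'I_(sp_size h)) := sp_time h i.
Let v (i : 'I_(sp_size h)) := sp_time h i.+1.
Let e (i : 'I_(sp_size h)) := sp_value h i.

Let time_mono i j : (i <= j)%N -> (j <= sp_size h)%N -> sp_time h i <= sp_time h j.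
Proof.
move=> /subnKC <-; elim: (j - i)%N => [|k IH]; first by rewrite addn0.
rewrite addnS => ijn; apply: (le_trans (IH (ltnW ijn))).
exact: sp_time_le.
Qed.

Lemma simple_adapted : adapted_steps P W X0 u v e.
Proof.
move=> i; have iN := ltn_ord i; split.
- by rewrite /u -(sp_time0 h) time_mono// ltnW.
- exact: sp_time_le.
- by apply/square_integrableP; exact: sp_value_sqint.
- exact: sp_value_adapted.
Qed.

Lemma simple_end i : v i <= t.
Proof. by rewrite /v -[leRHS](sp_time_end h) time_mono. Qed.

Lemma cut_simple s : cut s (simple_fun h) = steps_process u v e s.
Proof.
apply/funext => z; rewrite /cut /simple_fun /steps_process mulr_sumr.
by apply: eq_bigr => i _; rewrite /step_process mulrA mulrAC.
Qed.

Lemma simple_ito_steps : simple_ito h W = steps_integral W u v e t.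
Proof.
apply/funext => w; apply: eq_bigr => i _; rewrite /step_integral.
rewrite (min_l (simple_end i)) (min_l (le_trans _ (simple_end i)))//.
by have [] := simple_adapted i.
Qed.

Lemma simple_fun_measurable :
  measurable_fun setT (fun p : R * T => simple_fun h p.1 p.2).
Proof.
rewrite /simple_fun; under eq_fun do rewrite -(mul1r (\sum_(_ < _) _)) mulr_sumr.
apply: measurable_sum => i; have [_ _ [me _] _] := simple_adapted i.
under eq_fun do rewrite mul1r.
apply: measurable_funM; first exact: (measurableT_comp me).
have mitv : measurable (`[sp_time h i, sp_time h i.+1[ : set R) by [].
have mi : measurable_fun setT (\1_`[sp_time h i, sp_time h i.+1[ : R -> R).
  exact: measurable_indic.
exact: (measurableT_comp mi).
Qed.

End simple.
Arguments simple_adapted {t} h.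

Lemma cut_L2_le s t (H K : R -> T -> R) : s <= t ->
  L2 pi (cut t H) -> L2 pi (cut t K) -> L2 pi (cut s H) -> L2 pi (cut s K) ->
  \int[pi]_z ((cut s H z - cut s K z) ^+ 2) <=
  \int[pi]_z ((cut t H z - cut t K z) ^+ 2).
Proof.
move=> st H2 K2 Hs Ks; apply: le_Rintegral => //.
- by have [] := L2B Hs Ks.
- by have [] := L2B H2 K2.
- move=> [r w] _; rewrite /cut/= -!mulrBr !exprMn ler_wpM2r ?sqr_ge0// !indicE.
  rewrite -!natrX ler_nat; case: (boolP (r \in `[0, s[%classic)) => //= rs.
  suff -> : r \in `[0, t[%classic by [].
  move: rs; rewrite !inE/= !in_itv/= => /andP[-> /lt_le_trans]; exact.
Qed.

Variable H : R -> T -> R.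

Definition ito_approximation t (I : T -> R) (h : nat -> simple_process P F t) :=
  [/\ L2 P I, L2 pi (cut t H),
      L2cvg P (fun n => simple_ito (h n) W) I &
      L2cvg pi (fun n => cut t (simple_fun (h n))) (cut t H)].

Lemma is_ito_integral_approximation t I : is_ito_integral P F W H t I ->
  exists h : nat -> simple_process P F t, ito_approximation I h.
Proof.
move=> [iH mI [h [cH cI]]].
have [mH _ _] := iH; have H2 := cut_L2 iH.
have S2 n : L2 P (simple_ito (h n) W).
  rewrite simple_ito_steps.
  exact: (steps_integral_L2 hW mX0 X0W (simple_adapted (h n))).
have I2 : L2 P I.
  (* Convergence to 0 in [\bar R] makes the second moment of I - S_N finite for some N; as the
     simple integral S_N is in L^2, so is I. *)
  move/fine_cvgP : cI => [[N _ HN] _]; have := HN N (leqnn N).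
  rewrite /= second_momentE => fin.
  have IS2 : L2 P (I \- simple_ito (h N) W).
    have mIS : measurable_fun setT (I \- simple_ito (h N) W).
      by apply: measurable_funB => //; case: (S2 N).
    split => //; apply: L1P; first exact: measurable_funX.
    under eq_integral do rewrite ger0_norm ?sqr_ge0//.
    by rewrite ltey_eq fin.
  have -> : I = (fun w => (I \- simple_ito (h N) W) w + simple_ito (h N) W w).
    by apply/funext => w /=; rewrite subrK.
  exact: L2D.
exists h; split => //.
- apply: cvg_trans (fine_cvg cI); apply: near_eq_cvg; apply: nearW => n /=.
  rewrite second_momentE; congr fine; apply: eq_integral => w _ /=.
  by rewrite -sqrrN opprB.
- apply: cvg_trans (fine_cvg cH); apply: near_eq_cvg; apply: nearW => n /=.
  rewrite energyE; last first.
    apply: measurable_funB => //; apply: measurable_funTS.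
    exact: simple_fun_measurable.
  congr fine; apply: eq_integral => z _; congr (_%:E).
  by rewrite /cut -mulrBr -[in RHS]opprB mulrN sqrrN.
Qed.

(** The norms of the approximations coincide by the simple isometry and converge on both sides. *)
Lemma ito_isometry t I : is_ito_integral P F W H t I ->
  \int[P]_w (I w ^+ 2) = \int[pi]_z (cut t H z ^+ 2).
Proof.
move=> /is_ito_integral_approximation[h [I2 H2 cI cH]].
have S2 n : L2 P (simple_ito (h n) W).
  rewrite simple_ito_steps.
  exact: (steps_integral_L2 hW mX0 X0W (simple_adapted (h n))).
have K2 n : L2 pi (cut t (simple_fun (h n))).
  by rewrite cut_simple; exact: (steps_process_L2 (simple_adapted (h n))).
have lI := L2cvg_norm S2 I2 cI.
have := L2cvg_norm K2 H2 cH.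
rewrite (_ : (fun n => \int[pi]_z _) =
    (fun n => \int[P]_w (simple_ito (h n) W w ^+ 2))).
  by move=> lH; exact: (cvg_unique _ lI lH).
apply/funext => n; rewrite cut_simple simple_ito_steps.
have A := simple_adapted (h n).
have := steps_isometry hW mX0 X0W t A A.
under eq_Rintegral do rewrite -expr2.
by under [X in _ = X -> _]eq_Rintegral do rewrite -expr2.
Qed.

(* By the isometry, the integrals over [0, s] of the simple processes that
   approximate [H] on [0, t] converge to [Is]. *)
Lemma ito_martingale s t Is It (G : T -> R) : 0 <= s -> s <= t ->
  is_ito_integral P F W H s Is -> is_ito_integral P F W H t It ->
  L2 P G -> measurable_wrt (F s) G ->
  \int[P]_w (G w * It w) = \int[P]_w (G w * Is w).
Proof.
move=> s0 st /is_ito_integral_approximation[k [Is2 Hs2 cIs cHs]].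
move=> /is_ito_integral_approximation[h [It2 Ht2 cIt cHt]] G2 GF.
have Sk n : L2 P (simple_ito (k n) W).
  rewrite simple_ito_steps.
  exact: (steps_integral_L2 hW mX0 X0W (simple_adapted (k n))).
have Sh n : L2 P (simple_ito (h n) W).
  rewrite simple_ito_steps.
  exact: (steps_integral_L2 hW mX0 X0W (simple_adapted (h n))).
have C2 r x (g : simple_process P F x) : L2 pi (cut r (simple_fun g)).
  by rewrite cut_simple; exact: (steps_process_L2 (simple_adapted g)).
pose Shs n := steps_integral W (fun i : 'I_(sp_size (h n)) => sp_time (h n) i)
  (fun i => sp_time (h n) i.+1) (fun i => sp_value (h n) i) s.
have Shs2 n : L2 P (Shs n).
  exact: (steps_integral_L2 hW mX0 X0W (simple_adapted (h n))).
have cShs : L2cvg P Shs Is.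
  (* Since [h] on [0, t] and [k] on [0, s] are unrelated, pass from [Shs n] to [Is] through the
     integral of [k n]. The isometry turns the distance between these two simple integrals into a
     distance of processes on [0, s], which is split once more at H; the part with [h n] is at most
     its value on [0, t]. *)
  pose B n :=
    2 * (2 * \int[pi]_z ((cut t (simple_fun (h n)) z - cut t H z) ^+ 2) +
         2 * \int[pi]_z ((cut s (simple_fun (k n)) z - cut s H z) ^+ 2)) +
    2 * \int[P]_w ((simple_ito (k n) W w - Is w) ^+ 2).
  have bound n : \int[P]_w ((Shs n w - Is w) ^+ 2) <= B n.
    have isoE : \int[P]_w ((Shs n w - simple_ito (k n) W w) ^+ 2) =
        \int[pi]_z ((cut s (simple_fun (h n)) z - cut s (simple_fun (k n)) z) ^+ 2).
      rewrite simple_ito_steps !cut_simple.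
      exact: (steps_isometry_dist hW mX0 X0W s (simple_adapted (h n))
        (simple_adapted (k n))).
    have := L2_dist_le (Shs2 n) Is2 (Sk n).
    have := L2_dist_le (C2 s t (h n)) (C2 s s (k n)) Hs2.
    have := cut_L2_le st (C2 t t (h n)) Ht2 (C2 s t (h n)) Hs2.
    have -> : \int[P]_w ((Is w - simple_ito (k n) W w) ^+ 2) =
        \int[P]_w ((simple_ito (k n) W w - Is w) ^+ 2).
      by apply: eq_Rintegral => w _; rewrite -sqrrN opprB.
    rewrite isoE /B => DE QDK SQM; apply: (le_trans SQM).
    rewrite lerD2r ler_pM2l// (le_trans QDK)// lerD2r ler_pM2l//.
  apply: (@squeeze_cvgr _ _ _ _ (cst 0) B); [|exact: cvg_cst|].
    near=> n; rewrite (bound n) andbT.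
    by apply: Rintegral_ge0 => w _; exact: sqr_ge0.
  have -> : 0 = 2 * (2 * 0 + 2 * 0) + 2 * 0 :> R by ring.
  apply: cvgD; last by apply: cvgM => //; exact: cvg_cst.
  apply: cvgM; first exact: cvg_cst.
  by apply: cvgD; apply: cvgM => //; exact: cvg_cst.
have l1 := L2cvg_inner G2 Sh It2 cIt.
have l2 := L2cvg_inner G2 Shs2 Is2 cShs.
apply: (cvg_unique _ _ l2) => //; apply: cvg_trans l1.
apply: near_eq_cvg; apply: nearW => n /=; rewrite simple_ito_steps.
have A := simple_adapted (h n).
by rewrite (steps_integral_martingale hW mX0 X0W A s0 st)// => i; exact: simple_end.
Unshelve. all: by end_near. Qed.

End ito_integral.

(** * Time integrals of square-integrable processes *)

Section almost_everywhere.
Context d (T : measurableType d) (R : realType).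
Variable mu : {measure set T -> \bar R}.
Implicit Types f g : T -> R.

Lemma ae_eq_Rintegral f g : measurable_fun setT f -> measurable_fun setT g ->
  {ae mu, forall x, f x = g x} -> \int[mu]_x f x = \int[mu]_x g x.
Proof.
move=> mf mg fg; rewrite /Rintegral; congr fine; apply: ae_eq_integral => //.
- exact/measurable_EFinP.
- exact/measurable_EFinP.
- by apply: filterS fg => x /= -> _.
Qed.

Lemma ae_eq_L1 f g : measurable_fun setT f ->
  {ae mu, forall x, f x = g x} -> L1 mu g -> L1 mu f.
Proof.
move=> mf fg Ig; apply: L1P => //; have /integrableP[mg Igoo] := Ig.
rewrite (_ : (\int[mu]_x _ = \int[mu]_x `|(EFin \o g) x|)%E)//.
apply: ge0_ae_eq_integral => //.
- by apply/measurable_EFinP; exact: measurableT_comp.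
- exact: measurableT_comp.
- by apply: filterS fg => x /= -> _.
Qed.

Lemma ae_eq_L2 f g : measurable_fun setT f ->
  {ae mu, forall x, f x = g x} -> L2 mu g -> L2 mu f.
Proof.
move=> mf fg [mg g2]; split => //; apply: ae_eq_L1 g2; first exact: measurable_funX.
by apply: filterS fg => x /= ->.
Qed.

End almost_everywhere.

Section time_integral.
Context d (T : measurableType d) (R : realType) (P : probability T R).
Local Notation leb := (@lebesgue_measure R).
Local Notation pi := (leb \x P)%E.
Variables (t : R) (f : measurableTypeR R * T -> R).
Hypotheses (t0 : 0 <= t) (f2 : L2 pi f).
Hypothesis supp : forall z, f z = \1_(`[0, t[%classic) z.1 * f z.

Definition time_integral (w : T) : R := \int[leb]_s f (s, w).

Let one_L2 : L2 leb (\1_(`[0, t[%classic)).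
Proof.
split; first exact: measurable_indic.
have -> : (fun x : measurableTypeR R => \1_(`[0, t[%classic) x ^+ 2) =
    \1_(`[0, t[%classic) :> (R -> R).
  by apply/funext => x; rewrite expr2 indic_itvM maxxx minxx.
exact: L1_indic_itv.
Qed.

(** Lebesgue measure on the line is infinite, so Z is not by itself square-integrable on the
    product. The support condition inserts the indicator of [0, t[, which makes the integrand a
    product of two L^2 functions. *)
Lemma time_L1_tensor (Z : T -> R) : L2 P Z -> L1 pi (fun z => Z z.2 * f z).
Proof.
move=> Z2; have := L2_mul (L2_tensor one_L2 Z2) f2.
congr (L1 _ _); apply/funext => z; rewrite [in RHS]supp; ring.
Qed.

Lemma time_L1 : L1 pi f.
Proof.
have -> : f = (fun z => 1 * f z) by apply/funext => z; rewrite mul1r.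
apply: (@time_L1_tensor (fun=> 1)); split => //; exact: L1_cst.
Qed.

Let ae_L1 : {ae P, forall w, L1 leb (fun s => f (s, w))}.
Proof. exact: (ae_integrable2 time_L1). Qed.

Let ae_L2 : {ae P, forall w, L2 leb (fun s => f (s, w))}.
Proof.
have := ae_integrable2 f2.2; apply: filterS => w If; split => //.
exact: measurable_fun_pair1 f2.1.
Qed.

Lemma time_integral_measurable : measurable_fun setT time_integral.
Proof. by have [/L1_measurable] := Rfubini2 time_L1. Qed.

(** Cauchy-Schwarz against the indicator of [0, t[, whose squared norm is t; it applies to those
    paths that are square-integrable in time, which is almost all of them. *)
Lemma time_integral_sqr_ae : {ae P, forall w,
  time_integral w ^+ 2 <= t * \int[leb]_s (f (s, w) ^+ 2)}.
Proof.
apply: filterS ae_L2 => w fw.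
have -> : time_integral w = \int[leb]_s (\1_(`[0, t[%classic) s * f (s, w)).
  by apply: eq_Rintegral => s _; rewrite [LHS]supp.
apply: (le_trans (cauchy_schwarz one_L2 fw)).
have -> : \int[leb]_x (\1_(`[0, t[%classic) x ^+ 2) = t.
  under eq_Rintegral do rewrite expr2 indic_itvM maxxx minxx.
  by rewrite RintegralT_indic_itv subr0 max_r.
by [].
Qed.

Lemma time_integral_L2 : L2 P time_integral.
Proof.
split; first exact: time_integral_measurable.
have [If E] := Rfubini2 f2.2.
have Itf := L1Z t If.
apply: L1P; first by apply: measurable_funX; exact: time_integral_measurable.
have /integrableP[_] := Itf; apply: le_lt_trans.
apply: ae_ge0_le_integral => //.
- apply/measurable_EFinP; apply: measurableT_comp => //; apply: measurable_funX.
  exact: time_integral_measurable.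
- apply: measurableT_comp => //; exact: measurable_int Itf.
apply: filterS time_integral_sqr_ae => w H _ /=.
by rewrite lee_fin ger0_norm ?sqr_ge0// (le_trans H)// ler_norm.
Qed.

Lemma time_integral_inner (Z : T -> R) : L2 P Z ->
  L1 leb (fun s => \int[P]_w (Z w * f (s, w))) /\
  \int[P]_w (Z w * time_integral w) = \int[leb]_s (\int[P]_w (Z w * f (s, w))).
Proof.
move=> Z2; have Zf := time_L1_tensor Z2.
have [I1 E1] := Rfubini1 Zf; have [I2 E2] := Rfubini2 Zf.
split => //; rewrite [RHS]E1 -E2; apply: ae_eq_Rintegral.
- by apply: measurable_funM; [case: Z2|exact: time_integral_measurable].
- exact: L1_measurable I2.
(* Moving Z w across the time integral requires an integrable path, hence the equality for almost
   every w only. *)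
- by apply: filterS ae_L1 => w fw; rewrite /time_integral -RintegralTZ.
Qed.

End time_integral.

(** * The square of a time integral through its covariance kernel *)

Section triangle.
Context d (T : measurableType d) (R : realType) (P : probability T R).
Local Notation leb := (@lebesgue_measure R).
Local Notation pi := (leb \x P)%E.
Local Notation leb2 := (leb \x leb)%E.
Variables (t : R) (f : measurableTypeR R * T -> R).
Hypotheses (t0 : 0 <= t) (f2 : L2 pi f).
Hypothesis supp : forall z, f z = \1_(`[0, t[%classic) z.1 * f z.
Hypothesis slice : forall s, L2 P (fun w => f (s, w)).

Let K (p : measurableTypeR R * measurableTypeR R) : R :=
  \int[P]_w (f (p.1, w) * f (p.2, w)).

Let M (s : measurableTypeR R) : R := \int[P]_w (f (s, w) ^+ 2).

Let ML1 : L1 leb M. Proof. by have [] := Rfubini1 f2.2. Qed.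

(** Serves the measurability of K: Tonelli gives the measurability of parameter integrals for
    nonnegative integrands, and polarization expresses K by such integrals. *)
Let K_polar p : K p = 2^-1 *
  (\int[P]_w ((f (p.1, w) + f (p.2, w)) ^+ 2) - (M p.1 + M p.2)).
Proof.
have p1 := slice p.1; have p2 := slice p.2; have p12 := L2_mul p1 p2.
have K2 := L1Z 2 p12; have I12 := L1D p1.2 p2.2.
rewrite /K /M -(RintegralTD p1.2 p2.2).
rewrite -RintegralTB//; last exact: (L2D p1 p2).2.
rewrite -RintegralTZ; last by apply: L1B => //; exact: (L2D p1 p2).2.
by apply: eq_Rintegral => w _; field.
Qed.

Let K_measurable : measurable_fun setT K.
Proof.
have mM := L1_measurable ML1; have mf := f2.1.
rewrite (_ : K = fun p => 2^-1 *
  (\int[P]_w ((f (p.1, w) + f (p.2, w)) ^+ 2) - (M p.1 + M p.2))); last first.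
  by apply/funext => p; exact: K_polar.
apply: measurable_funM => //; apply: measurable_funB; last first.
  by apply: measurable_funD; exact: (measurableT_comp mM).
pose F (q : (measurableTypeR R * measurableTypeR R) * T) : \bar R :=
  ((f (q.1.1, q.2) + f (q.1.2, q.2)) ^+ 2)%:E.
apply: (@measurableT_comp _ _ _ _ _ _ fine) => //.
apply: (measurable_fun_fubini_tonelli_F F); last by move=> q; rewrite lee_fin sqr_ge0.
apply/measurable_EFinP; apply: measurable_funX; apply: measurable_funD.
  apply: (measurableT_comp mf); apply: measurable_fun_pair => //.
  exact: (measurableT_comp measurable_fst measurable_fst).
apply: (measurableT_comp mf); apply: measurable_fun_pair => //.
exact: (measurableT_comp measurable_snd measurable_fst).
Qed.

Let K_supp p : K p = \1_(`[0, t[%classic) p.1 * (\1_(`[0, t[%classic) p.2 * K p).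
Proof.
have p12 := L2_mul (slice p.1) (slice p.2).
rewrite /K -(RintegralTZ _ p12) -(RintegralTZ _ (L1Z _ p12)).
by apply: eq_Rintegral => w _; rewrite [in LHS]supp [X in _ * X = _]supp/=; ring.
Qed.

(** |K (s, r)| <= M s + M r, but M s alone is not integrable over the plane; the support of K
    supplies the indicator of [0, t[ in the other variable. *)
Let K_L1 : L1 leb2 K.
Proof.
have I1 := L1_indic_itv (0 : R) t.
have J1 := L1_tensor ML1 I1; have J2 := L1_tensor I1 ML1.
apply: (L1_le K_measurable _ (L1D J1 J2)) => p /=.
have KM : `|K p| <= M p.1 + M p.2.
  have p1 := slice p.1; have p2 := slice p.2; have p12 := L2_mul p1 p2.
  rewrite /K /M -RintegralTD; [|exact: p1.2|exact: p2.2].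
  apply: (le_trans (le_normr_Rintegral measurableT p12)).
  apply: le_Rintegral => //.
  - exact: integrable_norm.
  - by apply: L1D; [exact: p1.2|exact: p2.2].
  - move=> w _; set x := f _; set y := f _.
    by rewrite ler_norml; apply/andP; split; nra.
rewrite [in leLHS]K_supp !indicE.
have M0 s : 0 <= M s by apply: Rintegral_ge0 => w _; exact: sqr_ge0.
by case: (p.1 \in _); case: (p.2 \in _);
  rewrite ?(mul0r, mulr0, mul1r, mulr1, normr0, add0r, addr0).
Qed.

Let A : set (measurableTypeR R * measurableTypeR R) := [set p | p.2 < p.1].
Let B : set (measurableTypeR R * measurableTypeR R) := [set p | p.1 < p.2].

Let mA : measurable A.
Proof.
have -> : A = (fun p : measurableTypeR R * measurableTypeR R =>
    p.2 < p.1) @^-1` [set true] by apply/seteqP; split => p.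
rewrite -[X in measurable X]setTI.
by apply: (@measurable_fun_ltr _ _ R setT snd fst).
Qed.

Let mB : measurable B.
Proof.
have -> : B = (fun p : measurableTypeR R * measurableTypeR R =>
    p.1 < p.2) @^-1` [set true] by apply/seteqP; split => p.
rewrite -[X in measurable X]setTI.
by apply: (@measurable_fun_ltr _ _ R setT fst snd).
Qed.

Let indic_K_L1 C : measurable C -> L1 leb2 (fun p => \1_C p * K p).
Proof.
move=> mC; apply: (L1_le _ _ (integrable_norm K_L1)).
  by apply: measurable_funM => //; exact: measurable_indic.
by move=> p /=; rewrite indicE; case: (_ \in _); rewrite ?mul1r// mul0r normr0.
Qed.

(* For [s] in [0, t] this is the integral of [f] over [0, s]. *)
Definition early_part (s : R) (w : T) : R :=
  time_integral (fun z => \1_(`[0, s[%classic) z.1 * f z) w.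

Let early_hyps s : 0 <= s -> let g := fun z => \1_(`[0, s[%classic) z.1 * f z in
  L2 pi g /\ (forall z, g z = \1_(`[0, s[%classic) z.1 * g z).
Proof.
move=> s0 g; split; last by move=> z; rewrite /g mulrA indic_itvM maxxx minxx.
apply: L2_le f2.
  apply: measurable_funM; last exact: f2.1.
  apply: measurableT_comp => //; exact: measurable_indic.
by move=> z; rewrite /g indicE; case: (_ \in _); rewrite ?mul1r// mul0r normr0.
Qed.

(** Fubini in the single time r. The triangle r < s also contains negative times, absent from [0,
    s[; there f vanishes, so both descriptions give the same integral. *)
Let early_inner s : \int[P]_w (f (s, w) * early_part s w) =
  \int[leb]_r (\1_A (s, r) * K (s, r)).
Proof.
have [s0|s0] := leP 0 s; last first.
  have fs0 w : f (s, w) = 0.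
    rewrite supp/= indicE memNset ?mul0r//= in_itv/= => /andP[].
    by rewrite leNgt s0.
  under eq_Rintegral do rewrite fs0 mul0r.
  under [RHS]eq_Rintegral do rewrite /K/=.
  rewrite [LHS]/Rintegral integral0 [RHS]/Rintegral integral0_eq// => r _.
  rewrite [X in (_ * X)%:E](_ : _ = 0) ?mulr0//.
  by rewrite /Rintegral integral0_eq// => w _; rewrite fs0 mul0r.
have [g2 gsupp] := early_hyps s0.
have [_ ->] := time_integral_inner g2 gsupp (slice s).
apply: eq_Rintegral => r _; rewrite /K/= -RintegralTZ; last exact: L2_mul.
apply: eq_Rintegral => w _.
have [r0|r0] := leP 0 r; last first.
  have -> : f (r, w) = 0; last by rewrite !mulr0.
  rewrite supp/= indicE memNset ?mul0r//= in_itv/= => /andP[].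
  by rewrite leNgt r0.
rewrite mulrCA; congr (_ * _); rewrite !indicE; congr (_%:R); congr nat_of_bool.
by apply/idP/idP; rewrite !inE/= in_itv/= r0.
Qed.

Lemma time_integral_sqr :
  L1 leb (fun s => \int[P]_w (f (s, w) * early_part s w)) /\
  \int[P]_w (time_integral f w ^+ 2) =
  2 * \int[leb]_s (\int[P]_w (f (s, w) * early_part s w)).
Proof.
have V2 := time_integral_L2 t0 f2 supp.
have [I1 E1] := Rfubini1 (indic_K_L1 mA).
have [I2 E2] := Rfubini2 (indic_K_L1 mB).
have early_fun : (fun s => \int[P]_w (f (s, w) * early_part s w)) =
   (fun s => \int[leb]_r (\1_A (s, r) * K (s, r))).
  by apply/funext => s; exact: early_inner.
split; first by rewrite early_fun.
rewrite early_fun mulr_natl mulr2n [X in X + _]E1.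
(* By symmetry of K, exchanging the variables turns the integral over one triangle into that over
   the other, so twice the first is the integral over both. *)
have -> : \int[leb]_s (\int[leb]_r (\1_A (s, r) * K (s, r))) =
    \int[leb]_r (\int[leb]_s (\1_B (s, r) * K (s, r))).
  apply: eq_Rintegral => s _; apply: eq_Rintegral => r _; congr (_ * _).
  by rewrite /K; apply: eq_Rintegral => w _; rewrite mulrC.
rewrite [X in _ + X]E2 -RintegralTD; [|exact: indic_K_L1|exact: indic_K_L1].
transitivity (\int[leb2]_p K p).
  have [_ <-] := Rfubini1 K_L1.
  transitivity (\int[P]_w (time_integral f w * time_integral f w)).
    by apply: eq_Rintegral => w _; rewrite expr2.
  have [_ ->] := time_integral_inner f2 supp V2.
  apply: eq_Rintegral => s _; rewrite /K/=.
  have [_ <-] := time_integral_inner f2 supp (slice s).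
  by apply: eq_Rintegral => w _; rewrite mulrC.
have AB : L1 leb2 (fun p => \1_A p * K p + \1_B p * K p).
  by apply: L1D; exact: indic_K_L1.
apply/eqP; rewrite -subr_eq0 -RintegralTB//.
have [_ <-] := Rfubini1 (L1B K_L1 AB).
(* The two open triangles miss only the diagonal, which meets each vertical section in one point. *)
rewrite [X in X == _](_ : _ = \int[leb]_s 0); first by rewrite /Rintegral integral0.
apply: eq_Rintegral => s _ /=.
rewrite /Rintegral (_ : (\int[leb]_r _ = \int[leb]_(r in [set s]) (K (s, r))%:E)%E).
  by rewrite integral_set1.
rewrite [RHS]integral_mkcond; apply: eq_integral => r _; rewrite patchE !indicE.
have inA : ((s, r) \in A) = (r < s) by apply/idP/idP; rewrite inE.
have inB : ((s, r) \in B) = (s < r) by apply/idP/idP; rewrite inE.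
have in1 : (r \in [set s]) = (r == s) by apply/idP/eqP; rewrite inE.
rewrite inA inB in1; case: ltgtP => [rs|sr|->].
- by rewrite mul1r mul0r addr0 subrr.
- by rewrite mul1r mul0r add0r subrr.
- by rewrite !mul0r addr0 subr0.
Qed.

End triangle.

(** * The second moment of a solution *)

Section solution.
Context d (T : measurableType d) (R : realType) (P : probability T R).
Variables (W : R -> T -> R) (X0 : T -> R).
Hypotheses (hW : wiener_process P W) (X02 : L2 P X0).
Hypothesis X0W : independent_of_process P X0 W.
Variables (a b : R) (Y : R -> T -> R).
Hypothesis hY : linear_sde_solution P W a b X0 Y.

Local Notation F := (augmented_filtration P X0 W).
Local Notation leb := (@lebesgue_measure R).
Local Notation pi := (leb \x P)%E.

Let mX0 : measurable_fun setT X0. Proof. by case: X02. Qed.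

Let V t := time_integral (cut t Y).

Let cut_supp t (H : R -> T -> R) z : cut t H z = \1_(`[0, t[%classic) z.1 * cut t H z.
Proof. by rewrite /cut mulrA indic_itvM maxxx minxx. Qed.

Let solution_cut_L2 t : 0 <= t -> L2 pi (cut t Y).
Proof. by move=> t0; have [/cut_L2] := hY.2 t t0. Qed.

Let solution_adapted s : 0 <= s -> measurable_wrt (F s) (Y s).
Proof. by move=> s0; have [[_ + _] _] := hY.2 s s0; apply; rewrite s0 lexx. Qed.

Let solution_measurable s : 0 <= s -> measurable_fun setT (Y s).
Proof.
move=> s0 _ B mB; apply: (filtration_measurable hW mX0 (t := s)).
by apply: solution_adapted => //; exists B.
Qed.

Let V_L2 t : 0 <= t -> L2 P (V t).
Proof.
move=> t0; apply: (time_integral_L2 t0 (solution_cut_L2 t0)) => z.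
exact: cut_supp.
Qed.

(** Identifies the drift of the equation, taken over the closed interval, with a V(t); the path must
    be integrable in time, which holds almost surely. *)
Let drift_ae t : 0 <= t ->
  {ae P, forall w, \int[leb]_(s in `[0, t]) (a * Y s w) = a * V t w}.
Proof.
move=> t0; have f2 := solution_cut_L2 t0.
have := ae_integrable2 (time_L1 f2 (@cut_supp t Y)); apply: filterS => w Iw.
have E : (fun s => a * Y s w) \_ `[0, t[ = (fun s => a * cut t Y (s, w)).
  apply/funext => s; rewrite patchE /cut/= indicE.
  by case: ifP => _; rewrite ?mul1r// mul0r mulr0.
rewrite -Rintegral_itv_bndo_bndc; last first.
  apply/integrable_mkcond => //; rewrite restrict_EFin E; exact: L1Z.
by rewrite Rintegral_mkcond E /V /time_integral -RintegralTZ.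
Qed.

Let solution_ae t : 0 <= t -> exists I : T -> R,
  [/\ is_ito_integral P F W (fun s w => b * Y s w) t I, L2 P I &
      {ae P, forall w, Y t w = X0 w + a * V t w + I w}].
Proof.
move=> t0; have [_ [I hI YE]] := hY.2 t t0; exists I; split => //.
  by have [h []] := is_ito_integral_approximation hW mX0 X0W hI.
by apply: filterS2 YE (drift_ae t0) => w -> ->.
Qed.

(** Finite energy yields this for almost every t only; for every t it follows from the equation,
    whose three terms are in L^2. *)
Lemma solution_L2 t : 0 <= t -> L2 P (Y t).
Proof.
move=> t0; have [I [_ I2 YE]] := solution_ae t0.
apply: (ae_eq_L2 _ YE); first exact: solution_measurable.
by apply: L2D => //; apply: L2D => //; apply: L2Z; exact: V_L2.
Qed.

Let slice_L2 t s : L2 P (fun w => cut t Y (s, w)).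
Proof.
rewrite /cut/= indicE; case: (boolP (s \in `[0, t[%classic)) => st /=.
  apply: L2Z; apply: solution_L2.
  by move: st; rewrite inE/= in_itv/= => /andP[].
rewrite (_ : (fun w => _) = fun=> 0); first exact: L2_0.
by apply/funext => w; rewrite mul0r.
Qed.

Let early_V t s w : 0 <= s -> s < t -> early_part (cut t Y) s w = V s w.
Proof.
move=> s0 st; rewrite /early_part /V; congr (time_integral _ w).
apply/funext => z; rewrite /cut mulrA indic_itvM maxxx min_l//.
exact: ltW.
Qed.

(** X0 is known at time 0, so the martingale property replaces I by the integral over [0, 0], whose
    second moment is 0 by the isometry. *)
Let ito_initial_orthogonal t I : 0 <= t ->
  is_ito_integral P F W (fun s w => b * Y s w) t I -> \int[P]_w (X0 w * I w) = 0.
Proof.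
move=> t0 hI; have [J [hJ J2 _]] := solution_ae (lexx 0).
rewrite (ito_martingale hW mX0 X0W (lexx 0) t0 hJ hI X02); last first.
  exact: filtration_initial.
have J0 : \int[P]_w (J w ^+ 2) = 0.
  rewrite (ito_isometry hW mX0 X0W hJ) /Rintegral integral0_eq// => z _.
  rewrite /cut indicE memNset ?mul0r ?expr0n//= in_itv/= => /andP[].
  by move=> /le_lt_trans/[apply]; rewrite ltxx.
have := cauchy_schwarz X02 J2; rewrite J0 mulr0 => le0.
by apply/eqP; rewrite -sqrf_eq0 eq_le le0 sqr_ge0.
Qed.

Let drift_inner t I s : 0 <= t ->
  is_ito_integral P F W (fun s w => b * Y s w) t I -> L2 P I ->
  \int[P]_w ((X0 w + I w) * cut t Y (s, w)) =
  \int[P]_w (cut t Y (s, w) ^+ 2) -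
    a * \int[P]_w (cut t Y (s, w) * early_part (cut t Y) s w).
Proof.
(* Both sides vanish for s outside [0, t[, so the identity holds for every real s and can be
   integrated over the whole line. *)
move=> t0 hI I2; case: (boolP (s \in `[0, t[%classic)) => st; last first.
  have c0 w : cut t Y (s, w) = 0 by rewrite /cut/= indicE (negbTE st) mul0r.
  under eq_Rintegral do rewrite c0 mulr0.
  under [in RHS]eq_Rintegral do rewrite c0 expr0n.
  under [X in _ = _ - a * X]eq_Rintegral do rewrite c0 mul0r.
  by rewrite /Rintegral integral0 mulr0 subr0.
have c1 w : cut t Y (s, w) = Y s w by rewrite /cut/= indicE st mul1r.
move: st; rewrite inE/= in_itv/= => /andP[s0 st].
under eq_Rintegral do rewrite c1.
under [in RHS]eq_Rintegral do rewrite c1.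
under [X in _ = _ - a * X]eq_Rintegral do rewrite c1 early_V//.
have [J [hJ J2 YE]] := solution_ae s0.
have Y2 := solution_L2 s0; have V2 := V_L2 s0.
have mart := ito_martingale hW mX0 X0W s0 (ltW st) hJ hI Y2 (solution_adapted s0).
have XY := L2_mul X02 Y2; have YI := L2_mul Y2 I2; have YJ := L2_mul Y2 J2.
have YV := L2_mul Y2 V2; have YVa := L1Z a YV.
transitivity (\int[P]_w (X0 w * Y s w) + \int[P]_w (Y s w * I w)).
  by rewrite -RintegralTD//; apply: eq_Rintegral => w _; ring.
rewrite mart -(RintegralTZ _ YV) -(RintegralTD XY YJ) -(RintegralTB Y2.2 YVa).
apply: ae_eq_Rintegral.
- exact: L1_measurable (L1D XY YJ).
- exact: L1_measurable (L1B Y2.2 YVa).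
by apply: filterS YE => w ->; ring.
Qed.

(** With Q the energy, E (X0 + I) V = Q - (a / 2) E V^2 and E I^2 = b^2 Q. In the expansion 2 a E
    (X0 + I) V + a^2 E V^2 = 2 a Q, so E V^2 drops out. *)
Lemma second_moment_identity t : 0 <= t ->
  \int[P]_w (Y t w ^+ 2) =
  \int[P]_w (X0 w ^+ 2) + (2 * a + b ^+ 2) * \int[pi]_z (cut t Y z ^+ 2).
Proof.
move=> t0; have [I [hI I2 YE]] := solution_ae t0.
have f2 := solution_cut_L2 t0; have fs := @cut_supp t Y; have V2 := V_L2 t0.
have Z2 := L2D X02 I2; set Q := \int[pi]_z _.
have [J1 ZV] := time_integral_inner f2 fs Z2.
have [J2 VV] := time_integral_sqr t0 f2 fs (slice_L2 t).
have [J3 Q1] := Rfubini1 f2.2.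
have ZVE : \int[P]_w ((X0 w + I w) * V t w) = Q - a * (2^-1 * \int[P]_w (V t w ^+ 2)).
  rewrite /V VV mulKf// ZV /Q -Q1.
  rewrite -(RintegralTZ _ J2) -RintegralTB//; last exact: L1Z.
  by apply: eq_Rintegral => s _; exact: drift_inner.
have IQ : \int[P]_w (I w ^+ 2) = b ^+ 2 * Q.
  rewrite (ito_isometry hW mX0 X0W hI) /Q -(RintegralTZ _ f2.2).
  by apply: eq_Rintegral => z _; rewrite /cut; ring.
have XI := ito_initial_orthogonal t0 hI.
have IXX := X02.2; have III := I2.2; have IXI := L1Z 2 (L2_mul X02 I2).
have IVV := L1Z (a ^+ 2) V2.2; have IZV := L1Z (2 * a) (L2_mul Z2 V2).
have E1 := L1D IXX IXI; have E2 := L1D E1 III; have E3 := L1D E2 IZV.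
have -> : \int[P]_w (Y t w ^+ 2) = \int[P]_w (X0 w ^+ 2 + 2 * (X0 w * I w) +
    I w ^+ 2 + (2 * a) * ((X0 w + I w) * V t w) + a ^+ 2 * V t w ^+ 2).
  apply: ae_eq_Rintegral.
  - by apply: measurable_funX; exact: solution_measurable.
  - exact: L1_measurable (L1D E3 IVV).
  by apply: filterS YE => w ->; ring.
rewrite (RintegralTD E3 IVV) (RintegralTD E2 IZV) (RintegralTD E1 III).
rewrite (RintegralTD IXX IXI) (RintegralTZ _ (L2_mul X02 I2)).
rewrite (RintegralTZ _ (L2_mul Z2 V2)) (RintegralTZ _ V2.2) XI IQ ZVE.
by field.
Qed.

Lemma solution_energy t : 0 <= t ->
  leb.-integrable `[0, t[ (fun s => (\int[P]_w (Y s w ^+ 2))%:E) /\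
  \int[pi]_z (cut t Y z ^+ 2) = \int[leb]_(s in `[0, t[) \int[P]_w (Y s w ^+ 2).
Proof.
move=> t0; have [J E] := Rfubini1 (solution_cut_L2 t0).2.
have cE : (fun s => \int[P]_w (Y s w ^+ 2)) \_ `[0, t[ =
    (fun s => \int[P]_w (cut t Y (s, w) ^+ 2)).
  apply/funext => s; rewrite patchE /cut/= indicE; case: ifP => _.
    by apply: eq_Rintegral => w _; rewrite mul1r.
  under eq_Rintegral do rewrite mul0r expr0n.
  by rewrite /Rintegral integral0.
split.
  apply/integrable_mkcond => //.
  have -> : (fun s => (\int[P]_w (Y s w ^+ 2))%:E) \_ `[0, t[ =
      EFin \o (fun s => \int[P]_w (cut t Y (s, w) ^+ 2)).
    by rewrite -cE -restrict_EFin.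
  exact: J.
rewrite -E [RHS]Rintegral_mkcond; apply: eq_Rintegral => s _.
exact: (esym (congr1 (fun g => g s) cE)).
Qed.

End solution.

(** * Exponential growth and stability *)

Section integral_equation.
Context (R : realType).
Local Notation leb := (@lebesgue_measure R).

(** Only integrability of m is assumed. The equation exhibits m as an affine function of a
    continuous primitive, so m is continuous, the fundamental theorem applies, and an integrating
    factor concludes. *)
Lemma linear_integral_equation (m : R -> R) (m0 c : R) :
  (forall t, 0 <= t -> leb.-integrable `[0, t[ (EFin \o m)) ->
  (forall t, 0 <= t -> m t = m0 + c * \int[leb]_(s in `[0, t[) m s) ->
  forall t, 0 <= t -> m t = m0 * expR (c * t).
Proof.
move=> Im mE t; rewrite le_eqVlt => /predU1P[<-|t0].
  by rewrite mE// set_itvco0 Rintegral_set0 !mulr0 addr0 expR0 mulr1.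
pose u := t + 1; have tu : t < u by rewrite ltrDl.
have u0 : 0 < u by rewrite (lt_trans t0).
have Iu : leb.-integrable `[0, u] (EFin \o m).
  (* Integrability is assumed on half-open intervals; the closed interval [0, u] is placed inside
     [0, u + 1[. *)
  have u1 : 0 <= u + 1 by rewrite addr_ge0// ltW.
  apply: integrableS (Im _ u1) => //.
  by apply: subset_itvl; rewrite bnd_simp ltrDl.
pose G (x : R) := \int[leb]_(s in `[0, x]) m s.
have mG x : 0 <= x -> x <= u -> m x = m0 + c * G x.
  move=> x0 xu; rewrite mE// /G Rintegral_itv_bndo_bndc//; exact: Im.
have cG : {within `[0, u], continuous G}.
  by apply: parameterized_integral_continuous => //; exact: ltW.
have [cGi cG0 _] := (continuous_within_itvP _ u0).1 cG.
have cm x : x \in `]0, u[ -> {for x, continuous m}.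
  move=> xu; have := xu; rewrite in_itv/= => /andP[x0 xu'].
  rewrite /prop_for /continuous_at (mG x (ltW x0) (ltW xu')).
  have cGx : m0 + c * G y @[y --> x] --> m0 + c * G x.
    apply: cvgD; first exact: cvg_cst.
    by apply: cvgM; [exact: cvg_cst|exact: cGi].
  apply: cvg_trans cGx; apply: near_eq_cvg.
  apply: filterS (near_in_itvoo xu) => y; rewrite in_itv/= => /andP[y0 yu].
  by rewrite mG// ltW.
have dG (x : R) : x \in `]0, u[ -> is_derive x 1 G (m x).
  move=> xu; have := xu; rewrite in_itv/= => /andP[x0 xu'].
  have [dGx G'x] := continuous_FTC1_closed xu' Iu x0 (cm _ xu).
  by apply: DeriveDef => //; rewrite -G'x derive1E.
(* The integrating factor is applied to m0 + c G, equal to m on [0, u] and built from the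
   differentiable G; its derivative cancels because G' = m = m0 + c G. *)
pose f (x : R) := (m0 + c * G x) * expR (- c * x).
have df (x : R) : x \in `]0, t[ -> is_derive x 1 f ((fun=> 0) x).
  rewrite in_itv/= => /andP[x0 xt]; have xu := lt_trans xt tu.
  have dGx : is_derive x 1 G (m x) by apply: dG; rewrite in_itv/= x0.
  have dl : is_derive x 1 (fun y : R => - c * y) (- c).
    by apply: is_derive_eq; rewrite /GRing.scale/=; ring.
  have de := is_derive1_comp (is_derive_expR _) dl.
  apply: is_derive_eq; rewrite /GRing.scale/= (mG x (ltW x0) (ltW xu)); ring.
have cf : {within `[0, t], continuous f}.
  have cG' : {within `[0, t], continuous G}.
    by apply: continuous_subspaceW cG; apply: subset_itvl; rewrite bnd_simp ltW.
  move=> x; apply: cvgM.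
    by apply: cvgD; [exact: cvg_cst|apply: cvgM; [exact: cvg_cst|exact: cG']].
  apply: (@continuous_subspaceT _ _ _ (fun y : R => expR (- c * y))) => y.
  apply: continuous_comp; last exact: continuous_expR.
  by apply: cvgM; [exact: cvg_cst|exact: cvg_id].
have [x _] := MVT t0 df cf.
have G0 : G 0 = 0 by rewrite /G set_itv1 Rintegral_set1.
rewrite mul0r /f G0 !mulr0 expR0 addr0 mulr1 => /eqP; rewrite subr_eq0 => /eqP fE.
rewrite -fE -(mG t (ltW t0) (ltW tu)) -mulrA -expRD mulNr addNr expR0 mulr1//.
Qed.

End integral_equation.

(** * Positivity of [phi] and the comparison of its values at z / 2 and z *)

Section phi.
Context (R : realType).
Implicit Types y z : R.

Lemma phi_gt0 z : z <= 0 -> 0 < phi z.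
Proof.
rewrite le_eqVlt /phi => /predU1P[->|z0]; first by rewrite eqxx ltr01.
by rewrite lt_eqF// nmulr_rgt0 ?invr_lt0// subr_lt0 expR_lt1.
Qed.

(* Equivalent to [tanh (y / 2) / (y / 2) <= 1]. *)
Let tanh_bound y : y < 0 -> y * (expR y + 1) <= 2 * (expR y - 1).
Proof.
(* g vanishes at 0 and is nonincreasing: g' x = e^x - 1 - x e^x <= 0 is 1 - x <= e^(-x) multiplied
   by e^x. *)
move=> y0; pose g (x : R) := 2 * (expR x - 1) - x * (expR x + 1).
have dg (x : R) : is_derive x 1 g ((fun x => expR x - 1 - x * expR x) x).
  by apply: is_derive_eq; rewrite /GRing.scale/=; ring.
have cg : {within `[y, 0], continuous g}.
  by apply: derivable_within_continuous => x _; case: (dg x).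
have [x _] := MVT y0 (fun x _ => dg x) cg.
have g0 : g 0 = 0 by rewrite /g expR0; ring.
rewrite g0 sub0r sub0r => E; rewrite -subr_ge0 -[X in 0 <= X]/(g y) -oppr_le0 E.
rewrite pmulr_lle0 ?oppr_gt0//.
have := ler_wpM2l (expR_ge0 x) (expR_ge1Dx (- x)).
by rewrite expRN divff ?gt_eqF ?expR_gt0// mulrDr mulr1 mulrN; lra.
Qed.

(** With y = z / 2 and E = e^y, phi (2 y) = phi y (E + 1) / 2, so the claim amounts to phi y <= (E +
    1) / 2, which is [tanh_bound]. In the factored difference E - 1 and the bracket are both
    nonpositive. *)
Lemma phi_half_sqr_le z : z <= 0 -> phi (z / 2) ^+ 2 <= phi z.
Proof.
rewrite le_eqVlt => /predU1P[->|z0]; first by rewrite mul0r /phi eqxx expr1n.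
have y0 : z / 2 < 0 by rewrite pmulr_llt0 ?invr_gt0.
set y := z / 2 in y0 *; have -> : z = 2 * y by rewrite /y; field.
have yn0 := lt_eqF y0.
have y2n0 : (2 * y == 0) = false by rewrite mulf_eq0 yn0 pnatr_eq0.
rewrite /phi yn0 y2n0 mulr_natl mulr2n expRD.
set E := expR y; have E1 : E < 1 by rewrite expR_lt1.
have H := tanh_bound y0; rewrite -/E in H.
rewrite -subr_ge0.
have -> : (E * E - 1) / (y + y) - ((E - 1) / y) ^+ 2 =
    (E - 1) * (y * (E + 1) - 2 * (E - 1)) / (2 * y ^+ 2).
  by field; rewrite yn0 /= -mulr2n -mulr_natl y2n0.
apply: mulr_ge0; last by rewrite invr_ge0 mulr_ge0// sqr_ge0.
by apply: mulr_le0; rewrite subr_le0// ltW.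
Qed.

End phi.

Section stability.
Context d (T : measurableType d) (R : realType) (P : probability T R).
Variables (W : R -> T -> R) (X0 : T -> R).
Hypotheses (hW : wiener_process P W) (X02 : L2 P X0).
Hypothesis X0W : independent_of_process P X0 W.

Let m0 := \int[P]_w (X0 w ^+ 2).

Lemma second_moment_solution (a b : R) (Y : R -> T -> R) :
  linear_sde_solution P W a b X0 Y ->
  forall t, 0 <= t -> second_moment P (Y t) = (m0 * expR ((2 * a + b ^+ 2) * t))%:E.
Proof.
move=> hY t t0; rewrite (second_moment_fine (solution_L2 hW X02 X0W hY t0)).
congr (_%:E).
apply: (@linear_integral_equation _ (fun t => \int[P]_w (Y t w ^+ 2)) m0) => // s s0.
  by have [] := solution_energy hY s0.
have [_ <-] := solution_energy hY s0.
exact: (second_moment_identity hW X02 X0W hY s0).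
Qed.

Lemma mean_square_stable_solution (a b : R) (Y : R -> T -> R) :
  linear_sde_solution P W a b X0 Y ->
  mean_square_stable P Y <-> m0 = 0 \/ 2 * a + b ^+ 2 < 0.
Proof.
move=> hY; set c := 2 * a + b ^+ 2.
have E := second_moment_solution hY.
have m00 : 0 <= m0 by apply: Rintegral_ge0 => w _; exact: sqr_ge0.
have nearE : \forall t \near +oo%R, (m0 * expR (c * t))%:E = second_moment P (Y t).
  by near=> t; rewrite E.
split=> [stable|m0c].
  have [c0|c0] := ltP c 0; [by right|left].
  (* For c >= 0 the second moment is at least m0 at all nonnegative times, so a zero limit forces m0
     <= 0. *)
  have /fine_cvg : (m0 * expR (c * t))%:E @[t --> +oo%R] --> 0%E.
    apply: cvg_trans stable; apply: near_eq_cvg.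
    by apply: filterS nearE => t ->.
  move=> /cvgr_to_ge H; apply/eqP; rewrite eq_le m00 andbT; apply: H.
  near=> t; rewrite /= ler_peMr// -expR0 ler_expR mulr_ge0//.
apply: cvg_trans (near_eq_cvg nearE) _.
apply: cvg_EFin; first exact: nearW.
have [->|c0] := m0c.
  by under eq_fun do rewrite /= mul0r; exact: cvg_cst.
rewrite -(mulr0 m0); apply: cvgM; first exact: cvg_cst.
have -> : (fun t : R => expR (c * t)) = (fun x => expR (- x)) \o (fun t => t * - c).
  by apply/funext => t /=; rewrite mulrN opprK mulrC.
apply: (cvg_comp _ _ _ (@cvgr_expR R)).
by apply: gt0_cvgMly; [rewrite oppr_gt0|exact: cvg_id].
Unshelve. all: by end_near. Qed.

End stability.

Theorem theorem2p7 (d : measure_display) (T : measurableType d) (R : realType)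
    (P : probability T R) (W : R -> T -> R) (X0 : T -> R)
    (hW : wiener_process P W)
    (hX0 : square_integrable P X0)
    (hX0W : independent_of_process P X0 W)
    (lambda zeta mu : R) (hlambda : lambda <= 0) (hzeta : zeta <= 0)
    (X : R -> T -> R)
    (hX : linear_sde_solution P W (lambda + zeta) mu X0 X)
    (hstable : mean_square_stable P X) :
  forall eta : R, 0 <= eta ->
  forall Xeta : R -> T -> R,
    linear_sde_solution P W
      (phi (eta * lambda) * (lambda + zeta)) (phi (eta / 2 * lambda) * mu)
      X0 Xeta ->
    mean_square_stable P Xeta.
Proof.
move=> eta eta0 Xeta hXeta.
have X02 : L2 P X0 by exact/square_integrableP.
apply/(mean_square_stable_solution hW X02 hX0W hXeta).
(* A null initial value says nothing about the coefficients, but it makes the modified solution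
   stable as well. *)
have [|c0] := (mean_square_stable_solution hW X02 hX0W hX).1 hstable; first by left.
right; have z0 : eta * lambda <= 0 by rewrite mulr_ge0_le0.
have phi0 := phi_gt0 z0; have := phi_half_sqr_le z0.
rewrite (_ : eta * lambda / 2 = eta / 2 * lambda); last by rewrite mulrAC.
set p := phi (eta * lambda) in phi0 *; set q := phi (eta / 2 * lambda) => qp.
(* From q^2 <= p, the modified exponent 2 p (lambda + zeta) + q^2 mu^2 is at most p times the
   original one, which is negative; p > 0 preserves the sign. *)
rewrite exprMn; apply: (@le_lt_trans _ _ (p * (2 * (lambda + zeta) + mu ^+ 2))).
  have := ler_wpM2r (sqr_ge0 mu) qp; lra.
by rewrite pmulr_rlt0.
Qed.
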